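(* Let $A=(a_n)_{n=1}^N$ and $A_k=(a_{nk})_{n=1}^N$, $k\in\mathbb N$, be elements of $\mathcal A_1$ (same $N\in\overline{\mathbb N}$), and let $\{\mathcal P_n\}_{n=1}^N$ and $\{\mathcal P_{nk}\}_{n=1}^N$, $k\in\mathbb N$, be sequences of pyramids. If $\sum_{n=1}^N|a_{nk}-a_n|\to0$ as $k\to\infty$ and, for each $n\in[N]$, $\mathcal P_{nk}$ converges weakly to $\mathcal P_n$ as $k\to\infty$, then $\sum_{n=1}^N\mathcal P_{nk}^{a_{nk}}$ converges weakly to $\sum_{n=1}^N\mathcal P_n^{a_n}$ as $k\to\infty$.
   Context: An mm-space is a triple $(X,d_X,\mu_X)$ with $(X,d_X)$ complete separable metric and $\mu_X$ a Borel probability measure; $\mathcal X$ is the set of mm-isomorphism classes. $Y\prec X$ means there is a 1-Lipschitz $f:X\to Y$ with $f_*\mu_X=\mu_Y$. The box distance $\square(X,Y)$ is the infimum of $\max\{\operatorname{dis}(S),1-\pi(S)\}$ over couplings $\pi$ of $\mu_X,\mu_Y$ and Borel $S\subset X\times Y$, $\operatorname{dis}(S)=\sup\{|d_X(x,x')-d_Y(y,y')|:(x,y),(x',y')\in S\}$. A pyramid is a nonempty box-closed subset of $\mathcal X$ closed downward under $\prec$ and directed. Pyramids $\mathcal P_k$ converge weakly to $\mathcal P$ if $\lim_k\inf_{Y\in\mathcal P_k}\square(X,Y)=0$ for all $X\in\mathcal P$ and $\liminf_k\inf_{Y\in\mathcal P_k}\square(X,Y)>0$ for all $X\in\mathcal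 X\setminus\mathcal P$. $\overline{\mathbb N}=\mathbb N\cup\{\infty\}$, $[N]=\{1,\dots,N\}$ or $\mathbb N$. $\mathcal A_1$: sequences $(a_n)_{n=1}^N$ with $a_n\in(0,1]$, $\sum a_n=1$. Direct sum $\sum_{n=1}^N\mathcal P_n^{a_n}$: set of $X\in\mathcal X$ admitting $X_n\in\mathcal P_n$ and 1-Lipschitz $f_n:X_n\to X$ with $\mu_X=\sum_na_n(f_n)_*\mu_{X_n}$. *)

(* Defs.v *)
From HB Require Import structures.
From mathcomp Require Import all_boot all_order all_algebra.
From mathcomp Require Import all_classical all_reals all_analysis.
From mathcomp Require Import Rstruct Rstruct_topology.
Set Implicit Arguments. Unset Strict Implicit. Unset Printing Implicit Defensive.
Import Order.TTheory GRing.Theory Num.Theory.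
Local Open Scope classical_set_scope.
Local Open Scope ring_scope.

Notation RR := Rdefinitions.R.

Definition is_metric (X : Type) (d : X -> X -> RR) : Prop :=
  [/\ forall x y, d x y = 0 <-> x = y,
      forall x y, d x y = d y x &
      forall x y z, d x z <= d x y + d y z].

Definition d_open (X : Type) (d : X -> X -> RR) (A : set X) : Prop :=
  forall x, A x -> exists2 e : RR, 0 < e & forall y, d x y < e -> A y.

Definition d_complete (X : Type) (d : X -> X -> RR) : Prop :=
  forall u : nat -> X,
    (forall e : RR, 0 < e -> exists M, forall m n, (M <= m)%N -> (M <= n)%N -> d (u m) (u n) < e) ->
    exists x, forall e : RR, 0 < e -> exists M, forall n, (M <= n)%N -> d (u n) x < e.

Definition d_separable (X : Type) (d : X -> X -> RR) : Prop :=
  exists s : nat -> X, forall x (e : RR), 0 < e -> exists n, d x (s n) < e.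

Record mm := MM {
  mm_disp : measure_display;
  mm_car : measurableType mm_disp;
  mm_d : mm_car -> mm_car -> RR;
  mm_metric : is_metric mm_d;
  mm_complete : d_complete mm_d;
  mm_separable : d_separable mm_d;
  mm_borel : (@measurable _ mm_car) = <<s d_open mm_d >>;
  mm_mu : probability mm_car RR
}.

Definition lip1 (X Y : mm) (f : mm_car X -> mm_car Y) : Prop :=
  forall x x', mm_d (f x) (f x') <= mm_d x x'.

Definition dominated (Y X : mm) : Prop :=
  exists f : mm_car X -> mm_car Y, lip1 f /\
    forall A, measurable A -> mm_mu Y A = mm_mu X (f @^-1` A).

Definition coupling (X Y : mm) (pi : probability (mm_car X * mm_car Y)%type RR) : Prop :=
  (forall A, measurable A -> pi (A `*` setT) = mm_mu X A) /\
  (forall B, measurable B -> pi (setT `*` B) = mm_mu Y B).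

Definition dis_le (X Y : mm) (S : set (mm_car X * mm_car Y)) (e : RR) : Prop :=
  forall p q, S p -> S q -> `| mm_d p.1 q.1 - mm_d p.2 q.2 | <= e.

Definition boxd (X Y : mm) : RR :=
  inf [set e : RR | 0 <= e /\
    exists (pi : probability (mm_car X * mm_car Y)%type RR) (S : set (mm_car X * mm_car Y)),
      [/\ coupling pi, measurable S, dis_le S e & 1 - fine (pi S) <= e]].

(* subsets of the space of mm-isomorphism classes, as predicates on mm-spaces *)
Definition inf_box (X : mm) (P : mm -> Prop) : RR := inf [set r : RR | exists2 Y, P Y & r = boxd X Y].

Definition box_closed (P : mm -> Prop) : Prop :=
  forall X, (forall e : RR, 0 < e -> exists2 Y, P Y & boxd X Y < e) -> P X.

Definition pyramid (P : mm -> Prop) : Prop :=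
  [/\ exists X, P X,
      box_closed P,
      (forall X Y, P X -> dominated Y X -> P Y) &
      (forall X Y, P X -> P Y -> exists2 Z, P Z & dominated X Z /\ dominated Y Z)].

Definition weak_conv (Pk : nat -> mm -> Prop) (P : mm -> Prop) : Prop :=
  (forall X, P X -> (fun k => inf_box X (Pk k)) @ \oo --> (0 : RR)) /\
  (forall X, ~ P X -> (0 < limn_einf (fun k => (inf_box X (Pk k))%:E))%E).

(* ---------- index sets [N], N in N \cup {oo} (0-based indices) ---------- *)
Inductive nbar := Fin of nat | Inf.

Definition idx (N : nbar) (n : nat) : Prop :=
  match N with Fin m => (n < m)%N | Inf => True end.

Definition sumN (N : nbar) (f : nat -> \bar RR) : \bar RR :=
  match N with
  | Fin m => (\sum_(n < m) f n)%E
  | Inf => (\sum_(n <oo) f n)%E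
  end.

Definition inA1 (N : nbar) (a : nat -> RR) : Prop :=
  (forall n, idx N n -> 0 < a n <= 1) /\ sumN N (fun n => (a n)%:E) = 1%E.

Definition dsum (N : nbar) (a : nat -> RR) (P : nat -> mm -> Prop) (X : mm) : Prop :=
  exists (Xs : nat -> mm) (f : forall n, mm_car (Xs n) -> mm_car X),
    [/\ forall n, idx N n -> P n (Xs n),
        forall n, idx N n -> lip1 (f n) &
        forall A, measurable A ->
          mm_mu X A = sumN N (fun n => ((a n)%:E * mm_mu (Xs n) (f n @^-1` A))%E)].

(* Main.v *)
(* A member [X] of a direct sum is the same thing as a decomposition
   [mu_X = sum_n a_n nu_n] with each [(X, nu_n)] in [P_n] (push the measures of
   the summands forward), so both halves of weak convergence are about such
   decompositions.

   Recovery.  Let [Phi : X -> R^m] be the tuple of distances to finitely many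
   points of a dense sequence; on a set of almost full measure it is almost
   isometric for the sup metric.  If [Y_nk] in [P_nk] is box-close to
   [(X, nu_n)], inf-convolution along the almost full set of a coupling carries
   [Phi] to a 1-Lipschitz map [Psi_n : Y_nk -> R^m], and
   [(R^m, sum_n a_nk (Psi_n)_* mu_(Y_nk))] lies in the direct sum at stage [k]
   and is box-close to [X].

   Limit.  If [Z_j], in the direct sum at stage [k_j], tends to [X], then
   Radon-Nikodym densities split the coupling of [X] and [Z_j], giving
   [mu_X = sum_n a_(n k_j) sigma_jn] with [(X, sigma_jn)] box-close to
   [P_(n k_j)].  Along an ultrafilter [sigma_jn A] converges for every Borel set
   [A]; the limit is finitely additive and bounded by [mu_X / a_n], hence a
   measure [tau_n].  Comparing masses on [A] and its complement gives
   [mu_X = sum_n a_n tau_n], and [(X, tau_n)] is in [P_n] because [sigma_jn] and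
   [tau_n] almost agree on a finite partition of [X] into small cells. *)
Require Import Defs.
From HB Require Import structures.
From mathcomp Require Import all_boot all_order all_algebra.
From mathcomp Require Import all_classical all_reals all_analysis.
From mathcomp Require Import Rstruct Rstruct_topology.
From mathcomp Require Import measurable_realfun.
From mathcomp Require Import ring lra.
Set Implicit Arguments.
Unset Strict Implicit.
Unset Printing Implicit Defensive.
Import Order.TTheory GRing.Theory Num.Theory.
Import numFieldNormedType.Exports.
Local Open Scope classical_set_scope.
Local Open Scope ring_scope.

(** * Probability measures *)

Section ProbabilityOfMeasure.
Context d (T : measurableType d) (R : realType).
Variables (mu : {measure set T -> \bar R}) (mu1 : mu setT = 1%E).

(** A fresh constant for [mu], so that the probability structure obtained from [mu1] has something
    to be attached to. *)
Definition prob_of_measure_fun : set T -> \bar R := mu.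

HB.instance Definition _ := Measure.on prob_of_measure_fun.
HB.instance Definition _ :=
  Measure_isProbability.Build _ _ _ prob_of_measure_fun mu1.

Lemma prob_of_measure : exists P : probability T R, forall A, P A = mu A.
Proof. by exists prob_of_measure_fun. Qed.

End ProbabilityOfMeasure.

Section ProbabilityReal.
Context d (T : measurableType d) (R : realType) (P : probability T R).

Lemma prE A : measurable A -> P A = (fine (P A))%:E.
Proof. by move=> mA; rewrite fineK// fin_num_measure. Qed.

Lemma prU A B : measurable A -> measurable B -> A `&` B = set0 ->
  fine (P (A `|` B)) = fine (P A) + fine (P B).
Proof. by move=> mA mB AB; rewrite measureU// fineD// fin_num_measure. Qed.

Lemma pr_ge0 A : 0 <= fine (P A).
Proof. exact: fine_ge0. Qed.

Lemma le_pr A B : measurable A -> measurable B -> A `<=` B ->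
  fine (P A) <= fine (P B).
Proof.
move=> mA mB AB; rewrite fine_le ?fin_num_measure//.
by rewrite le_measure ?inE.
Qed.

Lemma pr_le1 A : measurable A -> fine (P A) <= 1.
Proof. by move=> mA; rewrite -lee_fin -prE// probability_le1. Qed.

Lemma prT : fine (P setT) = 1.
Proof. by rewrite probability_setT. Qed.

Lemma prC A : measurable A -> fine (P (~` A)) = 1 - fine (P A).
Proof.
by move=> mA; rewrite probability_setC// fineB// ?fin_num_measure.
Qed.

Lemma prI_ge A B : measurable A -> measurable B ->
  fine (P A) - fine (P (~` B)) <= fine (P (A `&` B)).
Proof.
move=> mA mB; rewrite lerBlDr.
have -> : fine (P A) = fine (P (A `&` B)) + fine (P (A `\` B)).
  rewrite -{1}(setUIDK A B) prU//; first exact: measurableI.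
    exact: measurableD.
  by rewrite -subset0 => x [[_ Bx] [_ /(_ Bx)]].
rewrite lerD2l; apply: le_pr => //; first exact: measurableD.
exact: measurableC.
Qed.

Lemma pr_bigsetU (F : nat -> set T) n : (forall i, measurable (F i)) ->
  trivIset setT F ->
  fine (P (\big[setU/set0]_(i < n) F i)) = \sum_(i < n) fine (P (F i)).
Proof.
move=> mF tF; rewrite measure_semi_additive_ord//.
- by rewrite sum_fine// => i _; rewrite fin_num_measure.
- by move=> i j _ _ ij; apply/val_inj/tF.
- exact: bigsetU_measurable.
Qed.

End ProbabilityReal.

Section DominatedContent.
Context d (T : measurableType d) (R : realType) (mu : probability T R).
Variables (C : R) (m : set T -> R).
Hypothesis m_ge0 : forall A, measurable A -> 0 <= m A.
Hypothesis mU : forall A B, measurable A -> measurable B -> A `&` B = set0 ->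
  m (A `|` B) = m A + m B.
Hypothesis m_dom : forall A, measurable A -> m A <= C * fine (mu A).

(** [m] is controlled on measurable sets only, whereas a measure is a nonnegative function on all
    sets; hence the value 0 elsewhere. *)
Let m' (A : set T) : \bar R := if `[< measurable A >] then (m A)%:E else 0%E.

Let m'E A : measurable A -> m' A = (m A)%:E.
Proof. by move=> mA; rewrite /m' asboolT. Qed.

Let m0 : m set0 = 0.
Proof.
apply/eqP; rewrite eq_le m_ge0// andbT.
by have := m_dom (@measurable0 _ T); rewrite measure0/= mulr0.
Qed.

Let m'0 : m' set0 = 0%E. Proof. by rewrite m'E// m0. Qed.

Let m'_ge0 A : (0 <= m' A)%E.
Proof. by rewrite /m'; case: asboolP => // /m_ge0; rewrite lee_fin. Qed.

Let m_bigsetU (F : nat -> set T) n : (forall i, measurable (F i)) ->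
  trivIset setT F -> m (\big[setU/set0]_(i < n) F i) = \sum_(i < n) m (F i).
Proof.
move=> mF tF; elim: n => [|n IH]; first by rewrite !big_ord0.
rewrite !big_ord_recr/= mU ?IH//; first exact: bigsetU_measurable.
rewrite -subset0 => x []; rewrite -bigcup_mkord => -[i /= ni Fi] Fn.
have E : i = n by apply: tF => //; exists x.
by move: ni; rewrite E ltnn.
Qed.

(** Domination turns finite additivity into countable additivity: with [G n] the union of the first
    [n] sets, [m] of the remainder lies between 0 and [C] times its [mu]-mass, which tends to 0
    because [mu] is countably additive. *)
Let m'_sigma_additive : semi_sigma_additive m'.
Proof.
move=> F mF tF mUF; rewrite m'E//.
pose G n := \big[setU/set0]_(i < n) F i.
have mG n : measurable (G n) by exact: bigsetU_measurable.
have GU n : G n `<=` \bigcup_i F i.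
  by rewrite /G -bigcup_mkord; apply: bigcup_subset.
pose t n := \sum_(i < n) fine (mu (F i)).
have splitG (nu : set T -> R) n :
    (forall A B, measurable A -> measurable B -> A `&` B = set0 ->
      nu (A `|` B) = nu A + nu B) ->
    nu (\bigcup_i F i) = nu (G n) + nu (\bigcup_i F i `\` G n).
  move=> nuU; rewrite -nuU//; last by rewrite setDIK.
    by rewrite setDUK.
  exact: measurableD.
have tcvg : t n @[n --> \oo] --> fine (mu (\bigcup_i F i)).
  have /fine_cvgP[_] : (\sum_(0 <= i < n) mu (F i) @[n --> \oo] -->
      (fine (mu (\bigcup_i F i)))%:E)%E.
    by rewrite -prE//; exact: measure_semi_sigma_additive.
  apply: cvg_trans.
  apply: near_eq_cvg; near=> n => /=; rewrite /t big_mkord.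
  by rewrite sum_fine// => i _; rewrite fin_num_measure.
rewrite (_ : (fun n => _) = EFin \o (fun n => \sum_(i < n) m (F i))); last first.
  apply/funext => n /=; rewrite big_mkord -sumEFin.
  by apply: eq_bigr => i _; rewrite m'E.
apply: cvg_EFin; first by near=> n.
apply: (@squeeze_cvgr _ _ _ _
  (fun n => m (\bigcup_i F i) - C * (fine (mu (\bigcup_i F i)) - t n))
  (cst (m (\bigcup_i F i)))).
- near=> n; rewrite /= -m_bigsetU// -/(G n) (splitG m n)//.
  have /= -> := splitG (fine \o mu) n (@prU _ _ _ mu).
  have -> : t n = fine (mu (G n)) by rewrite pr_bigsetU.
  have mD : measurable (\bigcup_i F i `\` G n) by exact: measurableD.
  have := m_ge0 mD; have := m_dom mD; set x := fine _; set y := fine _; set z := m _.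
  by move=> *; lra.
- rewrite -[X in _ --> X]subr0 -(mulr0 C) -(subrr (fine (mu (\bigcup_i F i)))).
  by apply: cvgB; [exact: cvg_cst|apply: cvgMl_tmp; apply: cvgB => //; exact: cvg_cst].
- exact: cvg_cst.
Unshelve. all: by end_near. Qed.

HB.instance Definition _ := isMeasure.Build _ _ _ m' m'0 m'_ge0 m'_sigma_additive.

Lemma prob_of_content : m setT = 1 ->
  exists Q : probability T R, forall A, measurable A -> Q A = (m A)%:E.
Proof.
move=> mT1; have [|Q QE] := @prob_of_measure _ _ _ m'.
  by rewrite /= m'E ?mT1.
by exists Q => A mA; rewrite QE/= m'E.
Qed.

End DominatedContent.

Lemma prob_pushforward d d' (T : measurableType d) (T' : measurableType d')
    (R : realType) (P : probability T R) (f : T -> T') : measurable_fun setT f ->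
  exists Q : probability T' R, forall A, Q A = P (f @^-1` A).
Proof.
by move=> mf; exists (distribution P (mfun_Sub (mem_set mf))) => A.
Qed.

Lemma prob_product d d' (T : measurableType d) (T' : measurableType d')
    (R : realType) (P : probability T R) (Q : probability T' R) :
  exists pi : probability (T * T')%type R,
    forall A B, measurable A -> measurable B -> pi (A `*` B) = (P A * Q B)%E.
Proof.
have [|pi piE] := @prob_of_measure _ _ _ (P \x Q)%E.
  have := @product_measure1E _ _ _ _ _ P Q setT setT measurableT measurableT.
  by rewrite /= !probability_setT mule1 setXTT.
by exists pi => A B mA mB; rewrite piE [LHS]product_measure1E.
Qed.

Lemma setUX T T' (A B : set T) (C : set T') :
  (A `|` B) `*` C = A `*` C `|` B `*` C.
Proof. by apply/seteqP; split=> -[x y] /=; tauto. Qed.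

Lemma setXU T T' (A B : set T) (C : set T') :
  C `*` (A `|` B) = C `*` A `|` C `*` B.
Proof. by apply/seteqP; split=> -[x y] /=; tauto. Qed.

Lemma prob_measureD d (T : measurableType d) (R : realType)
    (rho : {measure set T -> \bar R}) (Q : probability T R) (c : R) :
  0 <= c -> (rho setT + c%:E = 1)%E ->
  exists P : probability T R, forall A, P A = (rho A + c%:E * Q A)%E.
Proof.
move=> c0 rho1; pose mu := measure_add rho (mscale (NngNum c0) Q).
have muE A : mu A = (rho A + c%:E * Q A)%E by exact: measure_addE.
have [|P PE] := @prob_of_measure _ _ _ mu.
  by rewrite [LHS]muE probability_setT mule1.
by exists P => A; rewrite PE; exact: muE.
Qed.

Lemma cvgr_real_dist_lt (R : realType) (T : Type) (F : set_system T)
    {FF : Filter F} (u : T -> R) (l e : R) :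
  u t @[t --> F] --> l -> 0 < e -> \forall t \near F, `|l - u t| < e.
Proof. by move=> /cvgrPdist_lt + e0 => /(_ _ e0). Qed.

Lemma real_cvgr_dist_le (R : realType) (T : Type) (F : set_system T)
    {FF : Filter F} (u : T -> R) (l : R) :
  (forall e, 0 < e -> \forall t \near F, `|l - u t| <= e) ->
  u t @[t --> F] --> l.
Proof. by move=> ul; apply/cvgrPdist_le. Qed.

(** Dividing by [m.+1] keeps the individual tolerance positive even when [m = 0], so it can serve as
    an epsilon in a limit. *)
Lemma ler_sum_const (R : realType) m (x : nat -> R) (e : R) : 0 <= e ->
  (forall i, (i < m)%N -> x i <= e / m.+1%:R) -> \sum_(i < m) x i <= e.
Proof.
move=> e0 xe; apply: (@le_trans _ _ (\sum_(i < m) e / m.+1%:R)).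
  by apply: ler_sum => i _; exact: xe.
rewrite sumr_const card_ord -[_ *+ m]mulr_natr -mulrA ler_piMr//.
by rewrite mulrC ler_pdivrMr// mul1r ler_nat.
Qed.

Lemma prob_mixture d (T : measurableType d) (R : realType) (a : nat -> R)
    (nu : nat -> probability T R) :
  (forall n, 0 <= a n) -> (\sum_(n <oo) (a n)%:E = 1)%E ->
  exists P : probability T R,
    forall A, (P A = \sum_(n <oo) (a n)%:E * nu n A)%E.
Proof.
move=> a0 a1; pose mu := mseries (fun n => mscale (NngNum (a0 n)) (nu n)) 0.
have muE A : mu A = (\sum_(n <oo) (a n)%:E * nu n A)%E by [].
have [|P PE] := @prob_of_measure _ _ _ mu.
  rewrite [LHS]muE -[RHS]a1; apply: eq_eseriesr => n _.
  by rewrite probability_setT mule1.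
by exists P => A; rewrite PE; exact: muE.
Qed.

(** * Couplings and the box distance *)

Definition mm_with (X : mm) (Q : probability (mm_car X) RR) : mm :=
  MM (@mm_metric X) (@mm_complete X) (@mm_separable X) (@mm_borel X) Q.

Section Metric.
Context (X : mm).
Implicit Types x y z p : mm_car X.

Lemma mm_dxx x : mm_d x x = 0.
Proof. by case: (@mm_metric X) => /(_ x x)[_ +] _ _; exact. Qed.

Lemma mm_dC x y : mm_d x y = mm_d y x.
Proof. by case: (@mm_metric X). Qed.

Lemma mm_dtri x y z : mm_d x z <= mm_d x y + mm_d y z.
Proof. by case: (@mm_metric X). Qed.

Lemma mm_d_ge0 x y : 0 <= mm_d x y.
Proof. by have := mm_dtri x y x; rewrite mm_dxx (mm_dC y x); lra. Qed.

Lemma d_open_measurable (A : set (mm_car X)) :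
  d_open (@mm_d X) A -> measurable A.
Proof. by move=> oA; rewrite mm_borel; exact: sub_sigma_algebra. Qed.

Lemma ball_measurable p (e : RR) : measurable [set x | mm_d p x < e].
Proof.
apply: d_open_measurable => x /= pxe; exists (e - mm_d p x); first lra.
by move=> y xy; have := mm_dtri p x y; lra.
Qed.

Lemma lip_real_measurable (g : mm_car X -> RR) :
  (forall x y, g x <= g y + mm_d x y) ->
  measurable_fun setT (g : mm_car X -> measurableTypeR RR).
Proof.
move=> glip; apply: (measurability _ (RGenOInfty.measurableE RR)) => //.
move=> _ [_ [r ->] <-]; rewrite setTI; apply: d_open_measurable => x /=.
rewrite in_itv/= andbT => rgx; exists (g x - r); first lra.
by move=> y xy; rewrite in_itv/= andbT; have := glip x y; lra.
Qed.

End Metric.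

Lemma lip1_measurable (X Y : mm) (f : mm_car X -> mm_car Y) :
  lip1 f -> measurable_fun setT f.
Proof.
move=> flip; apply: (measurability _ (@mm_borel Y)).
move=> _ [A oA <-]; rewrite setTI; apply: d_open_measurable => x /oA[e e0 eA].
by exists e => // y xy; apply: eA; exact: le_lt_trans (flip _ _) xy.
Qed.

Lemma dominated_pushforward (X Y : mm) (f : mm_car X -> mm_car Y) : lip1 f ->
  exists Q : probability (mm_car Y) RR, dominated (mm_with Q) X /\
    forall A, Q A = mm_mu X (f @^-1` A).
Proof.
move=> flip; have [Q QE] := prob_pushforward (mm_mu X) (lip1_measurable flip).
by exists Q; split => //; exists f; split.
Qed.

Section Box.
Context (X Y : mm).

Lemma boxd_le e pi (S : set (mm_car X * mm_car Y)) : 0 <= e ->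
  @coupling X Y pi -> measurable S -> dis_le S e -> 1 - fine (pi S) <= e ->
  boxd X Y <= e.
Proof.
move=> e0 cpi mS dS piS; apply: ge_inf; first by exists 0 => r [].
by split => //; exists pi, S.
Qed.

Lemma coupling_exists : exists pi, @coupling X Y pi.
Proof.
have [pi piE] := prob_product (mm_mu X) (mm_mu Y).
exists pi; split => [A mA|B mB]; rewrite piE//.
  by rewrite probability_setT mule1.
by rewrite probability_setT mul1e.
Qed.

Lemma boxd_has_inf : has_inf [set e : RR | 0 <= e /\
  exists (pi : probability (mm_car X * mm_car Y)%type RR)
         (S : set (mm_car X * mm_car Y)),
    [/\ coupling pi, measurable S, dis_le S e & 1 - fine (pi S) <= e]].
Proof.
split; last by exists 0 => r [].
have [pi cpi] := coupling_exists.
(* The value 1 is always admissible: the empty set has no distortion and misses mass 1. *)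
exists 1; split => //; exists pi, set0; split => //.
by rewrite measure0/= subr0.
Qed.

Lemma boxd_ge0 : 0 <= boxd X Y.
Proof. by apply: lb_le_inf; [case: boxd_has_inf|move=> r []]. Qed.

Lemma boxd_lt e : boxd X Y < e ->
  exists (pi : probability (mm_car X * mm_car Y)%type RR)
         (S : set (mm_car X * mm_car Y)),
    [/\ coupling pi, measurable S, dis_le S e & 1 - e <= fine (pi S)].
Proof.
rewrite -subr_gt0 => /inf_adherent/(_ boxd_has_inf)[r [r0 [pi [S [cpi mS dS piS]]]]].
rewrite -/(boxd X Y) addrC subrK => re.
exists pi, S; split => //; last by lra.
by move=> p q Sp Sq; rewrite (le_trans (dS _ _ Sp Sq))// ltW.
Qed.

(* The missing mass is filled in with the product of the two residual
   marginals. *)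
Lemma boxd_le_subcoupling e
    (rho : {measure set (mm_car X * mm_car Y)%type -> \bar RR}) S :
  (forall A, measurable A -> (rho (A `*` setT) <= mm_mu X A)%E) ->
  (forall B, measurable B -> (rho (setT `*` B) <= mm_mu Y B)%E) ->
  measurable S -> dis_le S e -> 0 <= e -> 1 - e <= fine (rho S) ->
  boxd X Y <= e.
Proof.
move=> rhoX rhoY mS dS e0 rhoS.
have rho1 : (rho setT <= 1)%E.
  by rewrite -setXTT -(probability_setT (mm_mu X)); exact: rhoX.
have rfin A : measurable A -> rho A \is a fin_num.
  move=> mA; rewrite ge0_fin_numE//; apply: le_lt_trans (ltry 1).
  by apply: le_trans rho1; rewrite le_measure ?inE.
have mX1 A : measurable A -> measurable (A `*` (@setT (mm_car Y))).
  by move=> mA; exact: measurableX.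
have mX2 B : measurable B -> measurable ((@setT (mm_car X)) `*` B).
  by move=> mB; exact: measurableX.
pose f A := fine (rho (A `*` setT)); pose g B := fine (rho (setT `*` B)).
have fE A : measurable A -> rho (A `*` setT) = (f A)%:E.
  by move=> mA; rewrite /f fineK// rfin//; exact: mX1.
have gE B : measurable B -> rho (setT `*` B) = (g B)%:E.
  by move=> mB; rewrite /g fineK// rfin//; exact: mX2.
have f_le A : measurable A -> f A <= fine (mm_mu X A).
  by move=> mA; rewrite -lee_fin -fE// -prE//; exact: rhoX.
have g_le B : measurable B -> g B <= fine (mm_mu Y B).
  by move=> mB; rewrite -lee_fin -gE// -prE//; exact: rhoY.
have fU A B : measurable A -> measurable B -> A `&` B = set0 ->
    f (A `|` B) = f A + f B.
  move=> mA mB AB; rewrite /f setUX measureU ?fineD ?rfin//; try exact: mX1.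
  by rewrite -setXI AB set0X.
have gU A B : measurable A -> measurable B -> A `&` B = set0 ->
    g (A `|` B) = g A + g B.
  move=> mA mB AB; rewrite /g setXU measureU ?fineD ?rfin//; try exact: mX2.
  by rewrite -setXI AB setX0.
have fT : f setT = fine (rho setT) by rewrite /f setXTT.
have gT : g setT = fine (rho setT) by rewrite /g setXTT.
set r := fine (rho setT) in fT gT.
have r1 : r <= 1 by rewrite -lee_fin /r fineK// rfin.
(* If no mass is missing, [rho] is itself a coupling: its marginals lie below probabilities of the
   same total mass, and comparing a set with its complement forces equality. *)
have [r_eq1|r_neq1] := eqVneq r 1.
  have [|pi piE] := @prob_of_measure _ _ _ rho.
    by rewrite -(fineK (rfin _ measurableT)) -/r r_eq1.
  apply: (@boxd_le e pi S) => //; last by rewrite piE; lra.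
  split => [A mA|B mB]; rewrite piE.
    rewrite fE// prE//; congr EFin; apply/eqP; rewrite eq_le f_le//=.
    have := f_le _ (measurableC mA); rewrite prC//.
    by have := fU A (~` A) mA (measurableC mA) (setICr _); rewrite setUCr fT r_eq1; lra.
  rewrite gE// prE//; congr EFin; apply/eqP; rewrite eq_le g_le//=.
  have := g_le _ (measurableC mB); rewrite prC//.
  by have := gU B (~` B) mB (measurableC mB) (setICr _); rewrite setUCr gT r_eq1; lra.
have s0 : 0 < 1 - r by rewrite subr_gt0 lt_neqAle r_neq1.
(* The residual marginals, normalised by the missing mass [1 - r], are probabilities because they
   are dominated by a multiple of the given measures. *)
have [||||QX QXE] := @prob_of_content _ _ _ (mm_mu X) (1 - r)^-1
  (fun A => (1 - r)^-1 * (fine (mm_mu X A) - f A)).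
- by move=> A mA; rewrite mulr_ge0 ?invr_ge0 ?(ltW s0)// subr_ge0 f_le.
- by move=> A B mA mB AB; rewrite fU// prU//; ring.
- move=> A mA; rewrite ler_wpM2l ?invr_ge0 ?(ltW s0)// gerBl.
  exact: fine_ge0.
- by rewrite prT fT mulVf// gt_eqF.
have [||||QY QYE] := @prob_of_content _ _ _ (mm_mu Y) (1 - r)^-1
  (fun A => (1 - r)^-1 * (fine (mm_mu Y A) - g A)).
- by move=> A mA; rewrite mulr_ge0 ?invr_ge0 ?(ltW s0)// subr_ge0 g_le.
- by move=> A B mA mB AB; rewrite gU// prU//; ring.
- move=> A mA; rewrite ler_wpM2l ?invr_ge0 ?(ltW s0)// gerBl.
  exact: fine_ge0.
- by rewrite prT gT mulVf// gt_eqF.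
have [Q QE] := prob_product QX QY.
have [|pi piE] := prob_measureD Q (ltW s0) (rho := rho).
  by rewrite -setXTT fE// fT -EFinD addrC subrK.
apply: (@boxd_le e pi S) => //.
  split => [A mA|B mB]; rewrite piE QE//.
    rewrite probability_setT mule1 QXE// fE// -EFinM -EFinD mulrA divff ?gt_eqF//.
    by rewrite mul1r addrC subrK -prE.
  rewrite probability_setT mul1e QYE// gE// -EFinM -EFinD mulrA divff ?gt_eqF//.
  by rewrite mul1r addrC subrK -prE.
suff : fine (rho S) <= fine (pi S) by lra.
rewrite fine_le ?rfin// ?fin_num_measure// piE leeDl//.
by rewrite mule_ge0// lee_fin ltW.
Qed.

End Box.

Lemma inf_box_le X (P : mm -> Prop) Y : P Y -> inf_box X P <= boxd X Y.
Proof.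
move=> PY; apply: ge_inf; last by exists Y.
by exists 0 => _ [Z _ ->]; exact: boxd_ge0.
Qed.

Lemma inf_box_ge0 X (P : mm -> Prop) : (exists Y, P Y) -> 0 <= inf_box X P.
Proof.
move=> [Y PY]; apply: lb_le_inf; first by exists (boxd X Y), Y.
by move=> _ [Z _ ->]; exact: boxd_ge0.
Qed.

Lemma inf_box_lt X (P : mm -> Prop) e : (exists Y, P Y) -> inf_box X P < e ->
  exists2 Y, P Y & boxd X Y < e.
Proof.
move=> [Y PY] lte; have [||_ [Z PZ ->]] :=
  @inf_adherent _ [set r : RR | exists2 Y, P Y & r = boxd X Y] (e - inf_box X P).
  by rewrite subr_gt0.
  by split; [exists (boxd X Y), Y|exists 0 => _ [Z _ ->]; exact: boxd_ge0].
rewrite -/(inf_box X P) addrC subrK => ?.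
by exists Z.
Qed.

(** * Splitting a coupling along a mixture *)

(** The series always runs over all naturals. Indices outside [N] are encoded by weight 0, and
    nothing is asked of [nu n] there. *)
Definition mixture (a : nat -> RR) (P : nat -> mm -> Prop) (X : mm) : Prop :=
  exists nu : nat -> probability (mm_car X) RR,
    (forall n, 0 < a n -> P n (mm_with (nu n))) /\
    (forall A, measurable A ->
      mm_mu X A = (\sum_(n <oo) (a n)%:E * nu n A)%E).

Lemma nneseries_ge_term (R : realType) (u : nat -> \bar R) n :
  (forall k, 0 <= u k)%E -> (u n <= \sum_(k <oo) u k)%E.
Proof.
move=> u0; apply: le_trans (nneseries_lim_ge n.+1 _) => //.
by rewrite big_nat_recr//= leeDr// sume_ge0.
Qed.

Section Density.
Context d (T : measurableType d) (R : realType) (P : probability T R).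
Variables (h : T -> \bar R).
Hypotheses (h0 : forall x, (0 <= h x)%E) (mh : measurable_fun setT h).

Let nu (A : set T) : \bar R := (\int[P]_(x in A) h x)%E.

Let nu0 : nu set0 = 0%E. Proof. by rewrite /nu integral_set0. Qed.

Let nu_ge0 A : (0 <= nu A)%E. Proof. by apply: integral_ge0. Qed.

Let nu_sigma_additive : semi_sigma_additive nu.
Proof.
move=> F mF tF mUF; rewrite /nu ge0_integral_bigcup//; last first.
  exact: measurable_funTS.
by apply: is_cvg_nneseries => n _ _; exact: integral_ge0.
Qed.

HB.instance Definition _ :=
  isMeasure.Build _ _ _ nu nu0 nu_ge0 nu_sigma_additive.

Lemma prob_density : (\int[P]_x h x = 1)%E ->
  exists Q : probability T R, forall A, Q A = (\int[P]_(x in A) h x)%E.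
Proof.
by move=> h1; have [//|Q QE] := @prob_of_measure _ _ _ nu; exists Q.
Qed.

End Density.

(* [pi_n] has density [d nu_n / d (sum a_k nu_k)], read on the second factor,
   with respect to [pi]. *)
Lemma coupling_mixture d d' (T : measurableType d) (T' : measurableType d')
    (R : realType) (pi : probability (T * T')%type R)
    (a : nat -> R) (nu : nat -> probability T' R) :
  (forall n, 0 <= a n) ->
  (forall B, measurable B ->
    pi (setT `*` B) = (\sum_(n <oo) (a n)%:E * nu n B)%E) ->
  exists rho : nat -> probability (T * T')%type R,
    (forall n B, 0 < a n -> measurable B -> rho n (setT `*` B) = nu n B) /\
    (forall C, measurable C -> pi C = (\sum_(n <oo) (a n)%:E * rho n C)%E).
Proof.
move=> a0 piE.
have [mu muE] := prob_pushforward pi (@measurable_snd _ _ T T').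
have muB B : measurable B -> mu B = (\sum_(n <oo) (a n)%:E * nu n B)%E.
  by move=> mB; rewrite muE -piE// setTX.
have hE n : exists h : T' -> \bar R, [/\ forall x, (0 <= h x)%E,
    measurable_fun setT h, (\int[mu]_x h x = 1)%E &
    0 < a n -> forall B, measurable B -> nu n B = (\int[mu]_(x in B) h x)%E].
  have [an0|] := ltP 0 (a n); last first.
    (* For a zero weight any density of integral 1 will do. *)
    move=> an0; exists (cst 1%E); split => //.
    by rewrite integral_cst// mul1e; exact: probability_setT.
  (* Absolute continuity holds because [a n] times [nu n] is one term of the series for [mu]. *)
  have [|h [h0 hfin hint hE]] := @radon_nikodym_sigma_finite _ _ _ mu (nu n).
    apply/null_content_dominatesP => B mB muB0; apply/eqP.
    rewrite eq_le measure_ge0 andbT.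
    have : ((a n)%:E * nu n B <= mu B)%E.
      rewrite muB//.
      apply: (@nneseries_ge_term _ (fun n => ((a n)%:E * nu n B)%E)) => k.
      by rewrite mule_ge0// lee_fin.
    have -> : mu B = 0%E by exact: muB0.
    by rewrite pmule_rle0// lte_fin.
  exists h; split => //.
    by case/integrableP: hint.
  by rewrite -(probability_setT (nu n)); exact/esym/hE.
have [h {}hE] := choice hE.
have h0 n x : (0 <= h n x)%E by have [] := hE n.
have mh n : measurable_fun setT (h n) by have [] := hE n.
have hsnd n B : measurable B ->
    (\int[pi]_(p in setT `*` B) h n p.2 = \int[mu]_(z in B) h n z)%E.
  move=> mB; rewrite setTX.
  rewrite -(ge0_integral_pushforward (@measurable_snd _ _ T T'))//.
    by apply: eq_measure_integral => A mA _; exact/esym/muE.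
  exact: measurable_funTS.
have mh2 n : measurable_fun setT (fun p : T * T' => h n p.2).
  exact: measurableT_comp (mh n) measurable_snd.
have rhoE n : exists rho : probability (T * T')%type R,
    forall C, rho C = (\int[pi]_(p in C) h n p.2)%E.
  apply: prob_density => //.
  by rewrite -setXTT hsnd//; have [] := hE n.
have [rho {}rhoE] := choice rhoE.
exists rho; split=> [n B an0 mB|C mC].
  by rewrite rhoE hsnd//; have [_ _ _ ->] := hE n.
pose s z := (\sum_(n <oo) (a n)%:E * h n z)%E.
have ms : measurable_fun setT s.
  apply: ge0_emeasurable_sum => [n x _ _|n _].
    by rewrite mule_ge0// lee_fin.
  exact: measurable_funeM.
(* The weighted densities sum to 1 almost everywhere, since [s] and 1 have the same [mu]-integral
   over every measurable set. Pulled back along the second projection, this recovers [pi]. *)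
have s1 : ae_eq mu setT (EFin \o cst 1) s.
  apply: integral_ae_eq => //.
    exact: finite_measure_integrable_cst.
  move=> B _ mB.
  have -> : (\int[mu]_(x in B) (EFin \o cst 1%R) x = mu B)%E.
    by rewrite -[RHS]mul1e -(integral_cst mu mB 1).
  rewrite muB//.
  rewrite integral_nneseries//; last 2 first.
    by move=> n; apply: measurable_funTS; exact: measurable_funeM.
    by move=> n x _; rewrite mule_ge0// lee_fin.
  apply: eq_eseriesr => n _; rewrite ge0_integralZl//; last 2 first.
    exact: measurable_funTS.
    by rewrite lee_fin.
  have [an0|an0] := ltP 0 (a n).
    by have [_ _ _ ->] := hE n.
  have -> : a n = 0 by apply/eqP; rewrite eq_le an0 a0.
  by rewrite !mul0e.
have s2 : ae_eq pi C (EFin \o cst 1) (fun p => s p.2).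
  have [N [mN N0 sN]] := s1.
  exists (snd @^-1` N); split.
  - by rewrite -[X in measurable X]setTI; exact: measurable_snd.
  - by rewrite -[RHS]N0; exact/esym/muE.
  - by move=> p /= np; apply: sN => /= sp; apply: np => _; exact: sp.
have -> : (pi C = \int[pi]_(p in C) (EFin \o cst 1%R) p)%E.
  by rewrite -[LHS]mul1e -(integral_cst pi mC 1).
transitivity (\int[pi]_(p in C) s p.2)%E.
  apply: ae_eq_integral => //; first exact/measurable_EFinP.
  by apply: measurable_funTS; exact: measurableT_comp ms measurable_snd.
rewrite integral_nneseries//; last 2 first.
  by move=> n; apply: measurable_funTS; exact: measurable_funeM.
  by move=> n x _; rewrite mule_ge0// lee_fin.
apply: eq_eseriesr => n _; rewrite rhoE ge0_integralZl//.
  exact: measurable_funTS.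
by rewrite lee_fin.
Qed.

(** Each part [rho n] of a good coupling keeps the same set [S]. Its mass off [S], weighted by
    [a n], is one term of the mass of [pi] off [S], hence at most [e]; this is the origin of the
    factor [1 / a n]. *)
Lemma mixture_near (X Z : mm) (a : nat -> RR) (P : nat -> mm -> Prop) e :
  (forall n, 0 <= a n <= 1) -> mixture a P Z -> boxd X Z < e ->
  exists sigma : nat -> probability (mm_car X) RR,
    (forall A, measurable A ->
      mm_mu X A = (\sum_(n <oo) (a n)%:E * sigma n A)%E) /\
    forall n, 0 < a n -> exists2 Y, P n Y & boxd (mm_with (sigma n)) Y <= e / a n.
Proof.
move=> a01 [nu [Pnu nuE]] XZe.
have a0 n : 0 <= a n by have /andP[] := a01 n.
have [pi [S [[piX piZ] mS dS piS]]] := boxd_lt XZe.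
have e0 : 0 <= e by rewrite (le_trans _ (ltW XZe))// boxd_ge0.
have [|rho [rhoZ rhoE]] := @coupling_mixture _ _ _ _ _ pi a nu a0.
  by move=> B mB; rewrite piZ// nuE.
have [sigma sigmaE] := choice (fun n =>
  prob_pushforward (rho n) (@measurable_fst _ _ (mm_car X) (mm_car Z))).
exists sigma; split=> [A mA|n an0].
  rewrite -piX// rhoE; last exact: measurableX.
  by apply: eq_eseriesr => n _; rewrite sigmaE setXT.
exists (mm_with (nu n)); first exact: Pnu.
have an1 : a n <= 1 by have /andP[] := a01 n.
(* The distortion bound [e] does not deteriorate, so [a n <= 1] is what fits it under [e / a n]. *)
have ean : e <= e / a n by rewrite ler_pdivlMr// ler_piMr.
apply: (@boxd_le (mm_with (sigma n)) (mm_with (nu n)) _ (rho n) S) => //.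
- exact: le_trans ean.
- split => [A mA|B mB] /=.
    by rewrite sigmaE setXT.
  exact: rhoZ.
- by move=> p q Sp Sq; exact: le_trans (dS _ _ Sp Sq) ean.
rewrite -prC// ler_pdivlMr// mulrC.
apply: (@le_trans _ _ (fine (pi (~` S)))); last by rewrite prC//; lra.
have mSC := measurableC mS.
rewrite -lee_fin EFinM -!prE// rhoE//.
apply: (@nneseries_ge_term _ (fun n => ((a n)%:E * rho n (~` S))%E)) => k.
by rewrite mule_ge0// lee_fin.
Qed.

(** * Perturbing the measure of an mm-space *)

Lemma finite_mixture d (T : measurableType d) (R : realType) m
    (w : nat -> R) (P : nat -> probability T R) : (forall i, 0 <= w i) ->
  exists rho : {measure set T -> \bar R}, forall A, measurable A ->
    rho A = (\sum_(i < m) w i * fine (P i A))%:E.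
Proof.
move=> w0; exists (msum (fun i => mscale (NngNum (w0 i)) (P i)) m) => A mA.
rewrite /msum -sumEFin; apply: eq_bigr => i _.
by rewrite /mscale/= EFinM -prE.
Qed.

(** Conditioning on [A] in multiplied form: a null [A] needs no separate treatment by users, as both
    sides then vanish and any [Q] serves. *)
Lemma prob_conditional d (T : measurableType d) (R : realType)
    (P : probability T R) A : measurable A ->
  exists Q : probability T R, forall B, measurable B ->
    fine (P A) * fine (Q B) = fine (P (A `&` B)).
Proof.
move=> mA; have [PA0|PA0] := eqVneq (fine (P A)) 0.
  exists P => B mB; rewrite PA0 mul0r; apply/eqP; rewrite eq_le fine_ge0//=.
  by rewrite -PA0; apply: le_pr => //; exact: measurableI.
have PAgt0 : 0 < fine (P A) by rewrite lt_neqAle eq_sym PA0 fine_ge0.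
have [||||Q QE] := @prob_of_content _ _ _ P (fine (P A))^-1
  (fun B => (fine (P A))^-1 * fine (P (A `&` B))).
- by move=> B mB; rewrite mulr_ge0 ?fine_ge0// invr_ge0 fine_ge0.
- move=> B C mB mC BC; rewrite setIUr prU ?mulrDr//; try exact: measurableI.
  by rewrite setIACA BC setI0.
- move=> B mB; rewrite ler_wpM2l ?invr_ge0 ?fine_ge0//.
  by apply: le_pr => //; exact: measurableI.
- by rewrite setIT mulVf.
by exists Q => B mB; rewrite QE//= mulrA divff// mul1r.
Qed.

Lemma sum_prI_le d (T : measurableType d) (R : realType) (P : probability T R)
    (F : nat -> set T) m B : (forall i, measurable (F i)) -> trivIset setT F ->
  measurable B -> \sum_(i < m) fine (P (F i `&` B)) <= fine (P B).
Proof.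
move=> mF tF mB; rewrite -(@pr_bigsetU _ _ _ P (fun i => F i `&` B)).
- apply: le_pr => //.
    by apply: bigsetU_measurable => i _; exact: measurableI.
  by rewrite -(bigcup_mkord m (fun i => F i `&` B)) => x [i _ []].
- by move=> i; exact: measurableI.
- by move=> i j _ _ [x [[Fi _] [Fj _]]]; apply: tF => //; exists x.
Qed.

(** The shape in which subcouplings occur in [boxd_perturb] and [mixture_recovery], where weights
    are minima of two masses and so some mass is lost in both marginals. *)
Lemma boxd_le_finite_mixture (X Y : mm) e m (w : nat -> RR)
    (P : nat -> probability (mm_car X * mm_car Y)%type RR) S :
  (forall i, 0 <= w i) ->
  (forall A, measurable A ->
    \sum_(i < m) w i * fine (P i (A `*` setT)) <= fine (mm_mu X A)) ->
  (forall B, measurable B ->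
    \sum_(i < m) w i * fine (P i (setT `*` B)) <= fine (mm_mu Y B)) ->
  measurable S -> dis_le S e -> 0 <= e ->
  1 - e <= \sum_(i < m) w i * fine (P i S) ->
  boxd X Y <= e.
Proof.
move=> w0 wX wY mS dS e0 wS.
have [rho rhoE] := finite_mixture m P w0.
apply: (@boxd_le_subcoupling X Y e rho S) => //.
- move=> A mA; rewrite rhoE; last exact: measurableX.
  by rewrite prE// lee_fin; exact: wX.
- move=> B mB; rewrite rhoE; last exact: measurableX.
  by rewrite prE// lee_fin; exact: wY.
- by rewrite rhoE.
Qed.

(* The sections of [S] over the cells [A i] need not be measurable; their open
   [del]-neighbourhoods [T i] are. *)
Lemma boxd_perturb (X Y : mm) (sigma sigma' : probability (mm_car X) RR)
    m (A : nat -> set (mm_car X)) (del e : RR) :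
  0 < del -> (forall i, measurable (A i)) -> trivIset setT A ->
  (forall i x y, A i x -> A i y -> mm_d x y <= del) ->
  \sum_(i < m) `|fine (sigma (A i)) - fine (sigma' (A i))| <= del ->
  1 - del <= \sum_(i < m) fine (sigma' (A i)) ->
  boxd (mm_with sigma') Y < e ->
  boxd (mm_with sigma) Y <= e + 4 * del.
Proof.
move=> del0 mA tA dA dist mass bXY.
have e0 : 0 <= e by rewrite (le_trans _ (ltW bXY))// boxd_ge0.
have [pi [S [[/= piX piY] mS dS piS]]] := boxd_lt bXY.
pose T i := [set y | exists p, [/\ S p, A i p.1 & mm_d y p.2 < del]].
have mT i : measurable (T i).
  apply: d_open_measurable => y [p [Sp Ap yp]].
  exists (del - mm_d y p.2); first lra.
  move=> z yz; exists p; split => //.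
  by have := mm_dtri z y p.2; rewrite (mm_dC z y); lra.
have mAT i : measurable (A i `*` (@setT (mm_car Y))) by exact: measurableX.
(* On the cell [A i] the new coupling is a product: [sigma] conditioned on [A i], times the second
   marginal of [pi] conditioned on [A i]. Its weight is the smaller of the two masses of the
   cell. *)
have [P PE] := choice (fun i => prob_conditional sigma (mA i)).
have [Q' Q'E] := choice (fun i => prob_conditional pi (mAT i)).
have [Q QE] := choice (fun i =>
  prob_pushforward (Q' i) (@measurable_snd _ _ (mm_car X) (mm_car Y))).
have [R RE] := choice (fun i => prob_product (P i) (Q i)).
have {}QE i B : measurable B ->
    fine (sigma' (A i)) * fine (Q i B) = fine (pi ((A i `*` setT) `&` (setT `*` B))).
  move=> mB; rewrite QE -setTX -Q'E; last exact: measurableX.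
  by rewrite piX.
pose w i := Num.min (fine (sigma (A i))) (fine (sigma' (A i))).
have w0 i : 0 <= w i by rewrite le_min !fine_ge0.
have ws i : w i <= fine (sigma (A i)) by rewrite ge_min lexx.
have ws' i : w i <= fine (sigma' (A i)) by rewrite ge_min lexx orbT.
have ws'' i : fine (sigma' (A i)) - w i <=
    `|fine (sigma (A i)) - fine (sigma' (A i))|.
  have := ler_norm (fine (sigma' (A i)) - fine (sigma (A i))).
  have := normr_ge0 (fine (sigma (A i)) - fine (sigma' (A i))).
  by rewrite /w minElt distrC; case: ltP => _; lra.
have RE' i B C : measurable B -> measurable C ->
    fine (R i (B `*` C)) = fine (P i B) * fine (Q i C).
  by move=> mB mC; rewrite RE// (prE (P i) mB) (prE (Q i) mC).
have tAT : trivIset setT (fun i => A i `*` (@setT (mm_car Y))).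
  by move=> i j _ _ [[x y] [[/= Ai _] [Aj _]]]; apply: tA => //; exists x.
pose S' := \big[setU/set0]_(i < m) (A i `*` T i).
have mAiT i : measurable (A i `*` T i) by exact: measurableX.
have mS' : measurable S' by exact: bigsetU_measurable.
apply: (@boxd_le_finite_mixture (mm_with sigma) Y _ m w R S') => //.
- move=> B mB; apply: le_trans (sum_prI_le sigma m mA tA mB).
  apply: ler_sum => i _; rewrite RE'// prT mulr1 -PE//.
  by rewrite ler_wpM2r// fine_ge0.
- move=> B mB; rewrite -[X in fine X]piY//.
  apply: le_trans (sum_prI_le pi m mAT tAT (measurableX measurableT mB)).
  apply: ler_sum => i _; rewrite RE'// prT mul1r -QE//.
  by rewrite ler_wpM2r// fine_ge0.
(* Every point of [S'] is within [del], in each factor, of a point of [S]. Two points and two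
   factors cost [4 * del] of distortion. *)
- move=> p q; rewrite /S' -!(bigcup_mkord m (fun i => A i `*` T i)).
  move=> [i _ [Ap [p' [Sp' Ap' pp']]]] [j _ [Aq [q' [Sq' Aq' qq']]]] /=.
  have := dS _ _ Sp' Sq'; rewrite /= !ler_norml => /andP[].
  have := dA _ _ _ Ap Ap'; have := dA _ _ _ Aq Aq'.
  have := mm_dtri p.1 p'.1 q.1; have := mm_dtri p'.1 q'.1 q.1.
  have := mm_dtri p'.1 p.1 q'.1; have := mm_dtri p.1 q.1 q'.1.
  have := mm_dtri p.2 p'.2 q.2; have := mm_dtri p'.2 q'.2 q.2.
  have := mm_dtri p'.2 p.2 q'.2; have := mm_dtri p.2 q.2 q'.2.
  rewrite (mm_dC p'.1 p.1) (mm_dC q'.1 q.1) (mm_dC p'.2 p.2) (mm_dC q'.2 q.2).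
  by move=> *; apply/andP; split; lra.
- by lra.
(* Cell by cell, the part of [S] over [A i] projects into [T i], so its mass is at most
   [sigma' (A i)] times [Q i (T i)]. Replacing [sigma' (A i)] by the weight [w i] loses at most the
   difference of the two masses. *)
have key : \sum_(i < m) (fine (pi ((A i `*` setT) `&` S)) -
    `|fine (sigma (A i)) - fine (sigma' (A i))|) <=
    \sum_(i < m) w i * fine (R i S').
  apply: ler_sum => i _.
  apply: (@le_trans _ _ (w i * fine (R i (A i `*` T i)))); last first.
    apply: ler_wpM2l => //; apply: le_pr => //.
    by rewrite /S' -(bigcup_mkord m (fun i => A i `*` T i)) => p Ap; exists i => //=.
  rewrite RE'//.
  have wP : w i * fine (P i (A i)) = w i.
    have := PE i (A i) (mA i); rewrite setIid => PAi.
    have [s0|s0] := eqVneq (fine (sigma (A i))) 0.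
      have -> : w i = 0 by apply/eqP; rewrite eq_le w0 -s0 ws.
      by rewrite mul0r.
    by rewrite (mulfI s0 (etrans PAi (esym (mulr1 _)))) mulr1.
  rewrite mulrA wP.
  have : fine (pi ((A i `*` setT) `&` S)) <= fine (sigma' (A i)) * fine (Q i (T i)).
    rewrite QE//; apply: le_pr => //; first exact: measurableI.
      by apply: measurableI => //; exact: measurableX.
    move=> p [[Ap _] Sp]; split => //; split => //=; exists p; split => //.
    by rewrite mm_dxx.
  have := ws'' i; have := ws' i; have := pr_le1 (Q i) (mT i).
  have := pr_ge0 (Q i) (T i).
  by set q := fine (Q i _); set u := w i; set v := fine (sigma' _); nra.
apply: le_trans key; rewrite sumrB.
(* The cells miss mass [del], and the difference of the measures costs another [del]. *)
suff : 1 - e - del <= \sum_(i < m) fine (pi ((A i `*` setT) `&` S)) by lra.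
pose U := \big[setU/set0]_(i < m) (A i `*` (@setT (mm_car Y))).
have mU : measurable U by exact: bigsetU_measurable.
have -> : \sum_(i < m) fine (pi ((A i `*` setT) `&` S)) = fine (pi (S `&` U)).
  rewrite /U setIC big_distrl/=.
  rewrite -(@pr_bigsetU _ _ _ pi (fun i => (A i `*` setT) `&` S))//.
    by move=> i; exact: measurableI.
  by move=> i j _ _ [x [[Fi _] [Fj _]]]; apply: tAT => //; exists x.
apply: le_trans (prI_ge pi mS mU); rewrite prC//.
rewrite (@pr_bigsetU _ _ _ pi (fun i => A i `*` setT))//.
under eq_bigr do rewrite piX//.
by lra.
Qed.

(** * Ultralimits of mixtures *)

(** Compactness of the unit interval gives a cluster point, and an ultrafilter converges to each of
    its cluster points. *)
Lemma ultra_cvg_bounded (R : realType) (U : set_system nat) (u : nat -> R) :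
  UltraFilter U -> (forall j, 0 <= u j <= 1) -> exists l : R, u j @[j --> U] --> l.
Proof.
move=> UU u01.
have [|l [_ lcl]] := @segment_compact R 0 1 (u @ U) _.
  have : U (u @^-1` `[0, 1]%classic) => //.
  by apply: filterE => j /=; rewrite in_itv/=; exact: u01.
exists l => V lV; have [//|UV] := in_ultra_setVsetC (u @^-1` V) UU.
by have [x [nVx /nVx]] := lcl (~` V) V UV lV.
Qed.

Lemma pr_mixture_partial d (T : measurableType d) (R : realType)
    (P : probability T R) (a : nat -> R) (nu : nat -> probability T R) A M :
  (forall n, 0 <= a n) -> measurable A ->
  (P A = \sum_(n <oo) (a n)%:E * nu n A)%E ->
  \sum_(n < M) a n * fine (nu n A) <= fine (P A).
Proof.
move=> a0 mA PE; rewrite -lee_fin -prE// PE -sumEFin.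
apply: le_trans (nneseries_lim_ge M _); last first.
  by move=> n _ _; rewrite mule_ge0// lee_fin.
by rewrite big_mkord lee_sum// => n _; rewrite EFinM -prE.
Qed.

Lemma ultralimit_mixture d (T : measurableType d) (R : realType)
    (P : probability T R) (U : set_system nat) (a : nat -> R)
    (ak : nat -> nat -> R) (sigma : nat -> nat -> probability T R) :
  UltraFilter U -> (forall n, 0 <= a n) -> (\sum_(n <oo) (a n)%:E = 1)%E ->
  (forall j n, 0 <= ak j n) -> (forall n, ak j n @[j --> U] --> a n) ->
  (forall j A, measurable A ->
    P A = \sum_(n <oo) (ak j n)%:E * sigma j n A)%E ->
  exists tau : nat -> probability T R,
    (forall n A, 0 < a n -> measurable A ->
      fine (sigma j n A) @[j --> U] --> fine (tau n A)) /\
    (forall A, measurable A -> P A = \sum_(n <oo) (a n)%:E * tau n A)%E.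
Proof.
move=> UU a0 a1 ak0 aka PE.
have lE n A : exists l : R, measurable A -> fine (sigma j n A) @[j --> U] --> l.
  have [mA|mA] := pselect (measurable A); last by exists 0.
  have [|l ll] := @ultra_cvg_bounded R U (fun j => fine (sigma j n A)) UU.
    by move=> j; rewrite pr_ge0 pr_le1.
  by exists l.
have {lE} [l lE] := choice (fun p => lE p.1 p.2).
pose L n A := l (n, A).
have {lE} LE n A : measurable A -> fine (sigma j n A) @[j --> U] --> L n A.
  exact: (lE (n, A)).
have PU : ProperFilter U by exact: ultra_proper.
have prodE n A : measurable A ->
    ak j n * fine (sigma j n A) @[j --> U] --> a n * L n A.
  by move=> mA; apply: cvgM; [exact: aka|exact: LE].
have L0 n A : measurable A -> 0 <= L n A.
  move=> mA; apply: (cvgr_to_ge (LE n A mA)).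
  by apply: nearW => j; exact: pr_ge0.
(* Finite partial sums pass to the limit and yield an inequality. It also gives the domination of
   each [L n] by [P] that makes the limit countably additive. *)
have partial M A : measurable A -> \sum_(n < M) a n * L n A <= fine (P A).
  move=> mA.
  have cv : \sum_(n < M) ak j n * fine (sigma j n A) @[j --> U] -->
      \sum_(n < M) a n * L n A.
    elim: M => [|M IH].
      rewrite big_ord0 (_ : (fun j => _) = cst 0); first exact: cvg_cst.
      by apply/funext => j; rewrite big_ord0.
    rewrite big_ord_recr/=.
    rewrite (_ : (fun j => _) = (fun j => \sum_(n < M) ak j n *
      fine (sigma j n A) + ak j M * fine (sigma j M A))).
      by apply: cvgD => //; exact: prodE.
    by apply/funext => j; rewrite big_ord_recr.
  apply: (cvgr_to_le cv).
  by apply: nearW => j; exact: pr_mixture_partial (ak0 j) mA (PE j A mA).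
have dom n A : measurable A -> a n * L n A <= fine (P A).
  move=> mA; apply: le_trans (partial n.+1 A mA); rewrite big_ord_recr/= lerDr.
  by apply: sumr_ge0 => i _; rewrite mulr_ge0// L0.
have tauE n : exists tau : probability T R, 0 < a n ->
    forall A, measurable A -> tau A = (L n A)%:E.
  have [an0|an0] := ltP 0 (a n); last by exists P.
  have [||||Q QE] := @prob_of_content _ _ _ P (a n)^-1 (L n).
  - exact: L0.
  - move=> A B mA mB AB.
    rewrite -(cvg_lim _ (LE n _ (measurableU _ _ mA mB)))//.
    apply: cvg_lim => //.
    rewrite (_ : (fun j => fine _) =
      (fun j => fine (sigma j n A) + fine (sigma j n B))).
      by apply: cvgD; exact: LE.
    by apply/funext => j; rewrite prU.
  - by move=> A mA; rewrite mulrC ler_pdivlMr// mulrC dom.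
  - rewrite -(cvg_lim _ (LE n _ measurableT))//; apply: cvg_lim => //.
    rewrite (_ : (fun j => fine _) = cst 1); first exact: cvg_cst.
    by apply/funext => j; rewrite prT.
  by exists Q.
have [tau {}tauE] := choice tauE.
have aL n A : measurable A -> a n * fine (tau n A) = a n * L n A.
  move=> mA; have [an0|an0] := ltP 0 (a n); first by rewrite tauE.
  have -> : a n = 0 by apply/eqP; rewrite eq_le an0 a0.
  by rewrite !mul0r.
have t0 n A : (0 <= (a n)%:E * tau n A)%E by rewrite mule_ge0// lee_fin.
have sum_le A : measurable A -> (\sum_(n <oo) (a n)%:E * tau n A <= P A)%E.
  move=> mA; apply: lime_le; first by apply: is_cvg_nneseries.
  apply: nearW => M; rewrite big_mkord [leRHS]prE//.
  apply: (@le_trans _ _ (\sum_(n < M) a n * L n A)%:E).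
    by rewrite -sumEFin lee_sum// => n _; rewrite (prE (tau n) mA) -EFinM aL.
  by rewrite lee_fin partial.
exists tau; split=> [n A an0 mA|A mA].
  by rewrite tauE//=; exact: LE.
apply/eqP; rewrite eq_le sum_le// andbT.
have mAC := measurableC mA.
have : (\sum_(n <oo) (a n)%:E * tau n A + \sum_(n <oo) (a n)%:E * tau n (~` A) = 1)%E.
  rewrite -nneseriesD// -a1; apply: eq_eseriesr => n _.
  rewrite -ge0_muleDr// -measureU//; last by rewrite setICr.
  by rewrite setUCr; have /= -> := probability_setT (tau n); rewrite mule1.
have := sum_le _ mA; have := sum_le _ mAC; rewrite probability_setC//.
rewrite (prE P mA).
have : (0 <= \sum_(n <oo) (a n)%:E * tau n A)%E by exact: nneseries_ge0.
have : (0 <= \sum_(n <oo) (a n)%:E * tau n (~` A))%E by exact: nneseries_ge0.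
case: (\sum_(n <oo) _)%E => [x| |]//; case: (\sum_(n <oo) _)%E => [y| |]//.
by rewrite -EFinD !lee_fin => _ _ ? ? [] ?; lra.
Qed.

Lemma dense_balls_mass (X : mm) (P : probability (mm_car X) RR)
    (s : nat -> mm_car X) (del : RR) :
  (forall x (e : RR), 0 < e -> exists n, mm_d x (s n) < e) -> 0 < del ->
  exists m, 1 - del <=
    fine (P (\big[setU/set0]_(i < m) [set x | mm_d (s i) x < del])).
Proof.
move=> ds del0; pose B i := [set x | mm_d (s i) x < del].
pose F n := \big[setU/set0]_(i < n) B i.
have mF n : measurable (F n).
  by apply: bigsetU_measurable => i _; exact: ball_measurable.
have FT : \bigcup_n F n = setT.
  apply/seteqP; split => // x _; have [n xn] := ds x del del0.
  exists n.+1 => //; rewrite /F -bigcup_mkord; exists n => //=.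
  by rewrite /B/= mm_dC.
have /fine_cvgP[_ cv] : P (F n) @[n --> \oo] --> 1%:E.
  rewrite -(probability_setT P) -FT; apply: nondecreasing_cvg_mu => //.
    by rewrite FT.
  move=> n m nm; apply/subsetPset; rewrite /F -!bigcup_mkord.
  by move=> x [i /= ni Bi]; exists i => //=; exact: leq_trans nm.
have [|M _ HM] := cvgr_gt _ cv (1 - del) (_ : 1 - del < 1); first lra.
by exists M; exact/ltW/HM/leqnn.
Qed.

(** Balls of radius [del / 2] about a dense sequence, made disjoint; finitely many of them carry
    almost all the mass. *)
Lemma small_partition (X : mm) (P : probability (mm_car X) RR) (del : RR) :
  0 < del -> exists m (A : nat -> set (mm_car X)),
    [/\ forall i, measurable (A i), trivIset setT A,
        forall i x y, A i x -> A i y -> mm_d x y <= del &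
        1 - del <= \sum_(i < m) fine (P (A i))].
Proof.
move=> del0; have [s ds] := @mm_separable X.
have del20 : 0 < del / 2 by lra.
have [m mP] := dense_balls_mass P ds del20.
pose B i := [set x | mm_d (s i) x < del / 2].
have mB i : measurable (B i) by exact: ball_measurable.
exists m, (seqDU B); split.
- by move=> i; exact: seqDU_measurable.
- exact: trivIset_seqDU.
- move=> i x y [+ _] [+ _]; rewrite /B/= => xB yB.
  by have := mm_dtri x (s i) y; rewrite (mm_dC x (s i)); lra.
- rewrite -pr_bigsetU; last exact: trivIset_seqDU.
    by rewrite -bigsetU_seqDU; apply: le_trans mP; lra.
  by move=> i; exact: seqDU_measurable.
Qed.

(** * Sup-norm spaces *)

(** The initial value 0 of the maximum also covers [m = 0], the one-point space used in
    [mixture_nonempty]. *)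
Definition supd m (u v : 'I_m -> RR) : RR :=
  \big[Num.max/0]_(i < m) `|u i - v i|.

Section SupMetric.
Context (m : nat).
Implicit Types u v : 'I_m -> RR.

Lemma supd_le u v e : 0 <= e -> (forall i, `|u i - v i| <= e) -> supd u v <= e.
Proof. by move=> e0 uv; apply: bigmax_le. Qed.

Lemma supd_ge u v i : `|u i - v i| <= supd u v.
Proof. exact: le_bigmax. Qed.

Lemma supd_ge0 u v : 0 <= supd u v.
Proof. exact: bigmax_ge_id. Qed.

Lemma supd_lt u v e : 0 < e -> (forall i, `|u i - v i| < e) -> supd u v < e.
Proof. by move=> e0 uv; apply: bigmax_lt. Qed.

Lemma supd_metric : is_metric (@supd m).
Proof.
split.
- move=> u v; split=> [uv0|->].
    apply/funext => i; apply/eqP; rewrite -subr_eq0 -normr_le0 -uv0.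
    exact: supd_ge.
  apply/eqP; rewrite eq_le supd_ge0 andbT; apply: supd_le => // i.
  by rewrite subrr normr0.
- by move=> u v; apply: eq_bigr => i _; rewrite distrC.
- move=> u v w; apply: supd_le => [|i]; first by rewrite addr_ge0 ?supd_ge0.
  by rewrite (le_trans (ler_distD (v i) _ _))// lerD ?supd_ge.
Qed.

Lemma supd_complete : d_complete (@supd m).
Proof.
move=> u uC.
have ucvg i : exists l : RR, u n i @[n --> \oo] --> l.
  apply/cvg_ex; apply: R_complete; apply: cauchy_exP => e e0.
  have [M HM] := uC e e0; exists (u M i); exists M => // n /= Mn.
  by rewrite -ball_normE/=; apply: le_lt_trans (supd_ge _ _ i) (HM _ _ _ _).
have [l ul] := choice ucvg.
exists l => e e0.
have : \forall n \near \oo, forall i : 'I_m, `|l i - u n i| < e.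
  apply: (@filter_forall _ _ (fun i n => `|l i - u n i| < e)) => i.
  exact: (cvgr_real_dist_lt (ul i)).
move=> [M _ HM]; exists M => n Mn; apply: supd_lt => // i.
by rewrite distrC; exact: HM.
Qed.

Lemma supd_separable : d_separable (@supd m).
Proof.
(* Rational points, enumerated by [pickle]; numbers that encode nothing go to the origin. *)
pose s n : 'I_m -> RR := if unpickle n is Some f then
  (fun i => ratr ((f : {ffun 'I_m -> rat}) i)) else (fun=> 0).
exists s => x e e0.
have qE i : exists q : rat, `|x i - ratr q| < e.
  have [|q] := @rat_in_itvoo RR (x i - e) (x i + e); first lra.
  rewrite in_itv/= => /andP[? ?]; exists q.
  by rewrite ltr_norml; apply/andP; split; lra.
have [q {}qE] := choice qE.
exists (pickle [ffun i => q i]); apply: supd_lt => // i.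
by rewrite /s pickleK ffunE.
Qed.

(** Generated by the open sets, so that [mm_borel] holds by [erefl] in [sup_mm]. *)
Definition sup_space := g_sigma_algebraType (d_open (@supd m)).

Definition sup_mm (Q : probability sup_space RR) : mm :=
  @MM _ sup_space (@supd m) supd_metric supd_complete supd_separable erefl Q.

End SupMetric.

(** Dominated by every mm-space through a constant map, hence a member of every pyramid: the filler
    for summands that do not matter. *)
Definition sup_dirac m : probability (sup_space m) RR :=
  @dirac _ (sup_space m) (fun=> 0) RR.

Lemma coord_measurable m (i : 'I_m) :
  measurable_fun setT ((fun z => z i) : sup_space m -> measurableTypeR RR).
Proof.
apply: (@lip_real_measurable (sup_mm (sup_dirac m))) => u v.
by have := supd_ge u v i; have := ler_norm (u i - v i); rewrite /=; lra.
Qed.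

(** The closed tube of sup-norm width [e] about the graph of the map with coordinates [phi i]. *)
Definition graph_nbhd (X : mm) m (phi : 'I_m -> mm_car X -> RR) (e : RR) :
    set (mm_car X * sup_space m) :=
  [set p | forall i, `|phi i p.1 - p.2 i| <= e].

Lemma graph_nbhd_measurable (X : mm) m (phi : 'I_m -> mm_car X -> RR) (e : RR) :
  (forall i x y, phi i x <= phi i y + mm_d x y) ->
  measurable (graph_nbhd phi e).
Proof.
move=> philip.
pose h i : mm_car X * sup_space m -> measurableTypeR RR :=
  fun p => phi i p.1 - p.2 i.
have -> : graph_nbhd phi e = \bigcap_(i in [set: 'I_m]) (h i @^-1` `[- e, e]).
  apply/seteqP; split=> [p Gp i _|p Gp i] /=.
    by rewrite in_itv/= -ler_norml; exact: Gp.
  by have := Gp i Logic.I; rewrite /= in_itv/= -ler_norml.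
apply: fin_bigcap_measurable => [|i _]; first exact: finite_finset.
rewrite -[X in measurable X]setTI.
have mh : measurable_fun setT (h i).
  apply: measurable_funB.
    exact: measurableT_comp (lip_real_measurable (philip i)) measurable_fst.
  exact: measurableT_comp (coord_measurable i) measurable_snd.
exact: mh.
Qed.

(* The functions [phi i] are carried over to [Y] by inf-convolution along the
   almost full set [S] of a good coupling. *)
Lemma boxd_transfer (X Y : mm) m (phi : 'I_m -> mm_car X -> RR) (e : RR) :
  (forall i x, 0 <= phi i x) ->
  (forall i x y, phi i x <= phi i y + mm_d x y) ->
  boxd X Y < e -> e < 1 ->
  exists (tau : probability (sup_space m) RR)
         (pi : probability (mm_car X * sup_space m)%type RR),
    [/\ dominated (sup_mm tau) Y,
        forall A, measurable A -> pi (A `*` setT) = mm_mu X A,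
        forall B, measurable B -> pi (setT `*` B) = tau B &
        1 - e <= fine (pi (graph_nbhd phi e))].
Proof.
move=> phi0 philip bXY e1.
have e0 : 0 <= e by rewrite (le_trans _ (ltW bXY))// boxd_ge0.
have [pi [S [[piX piY] mS dS piS]]] := boxd_lt bXY.
(* As [e < 1], the set [S] has positive mass; its being nonempty makes the infima below genuine. *)
have [p0 Sp0] : S !=set0.
  apply/set0P/eqP => S0; move: piS; rewrite S0 measure0/=; lra.
pose E y i := [set r : RR | exists2 p, S p & r = phi i p.1 + mm_d y p.2].
have Elb y i : has_lbound (E y i).
  by exists 0 => _ [p _ ->]; rewrite addr_ge0// mm_d_ge0.
have E0 y i : E y i !=set0 by exists (phi i p0.1 + mm_d y p0.2), p0.
pose Psi (y : mm_car Y) : 'I_m -> RR := fun i => inf (E y i).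
have Psilip y y' i : Psi y i <= Psi y' i + mm_d y y'.
  rewrite -lerBlDr; apply: lb_le_inf => // _ [p Sp ->]; rewrite lerBlDr.
  have : Psi y i <= phi i p.1 + mm_d y p.2 by apply: ge_inf => //; exists p.
  by have := mm_dtri y y' p.2; lra.
pose Psi' : mm_car Y -> mm_car (sup_mm (sup_dirac m)) := Psi.
have Psi1 : lip1 Psi'.
  move=> y y'; apply: supd_le => [|i]; first exact: mm_d_ge0.
  rewrite ler_norml; have := Psilip y y' i; have := Psilip y' y i.
  by rewrite (mm_dC y' y) /Psi' => *; apply/andP; split; lra.
have [tau [tauY tauE]] := dominated_pushforward Psi1.
pose g (p : mm_car X * mm_car Y) : mm_car X * sup_space m := (p.1, Psi' p.2).
have mg : measurable_fun setT g.
  apply: measurable_fun_pair; first exact: measurable_fst.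
  exact: measurableT_comp (lip1_measurable Psi1) measurable_snd.
have [rho rhoE] := prob_pushforward pi mg.
exists tau, rho; split => //.
- by move=> A mA; rewrite rhoE -piX//; congr (pi _); apply/seteqP; split.
- move=> B mB; rewrite rhoE tauE -piY//.
  by rewrite -[X in measurable X]setTI; exact: lip1_measurable.
- apply: le_trans piS _; rewrite rhoE; apply: le_pr => //.
    rewrite -[X in measurable X]setTI; apply: mg => //.
    exact: graph_nbhd_measurable.
  (* At a point [p] of [S], using [p] itself as competitor bounds [Psi] above by [phi]. For any
     competitor [q], the Lipschitz bound on [phi] and the distortion of [S] bound it below by
     [phi - e]. *)
  move=> p Sp i /=; rewrite ler_norml; apply/andP; split.
    suff : Psi p.2 i <= phi i p.1 by rewrite /Psi'; lra.
    apply: ge_inf => //; exists p => //.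
    by rewrite mm_dxx addr0.
  suff : phi i p.1 - e <= Psi p.2 i by rewrite /Psi'; lra.
  apply: lb_le_inf => // _ [q Sq ->].
  have := philip i p.1 q.1; have := dS _ _ Sp Sq.
  by rewrite ler_norml => /andP[? ?] ?; lra.
Qed.

(** * Recovery sequences *)

Lemma series_head (R : realType) (a : nat -> R) (e : R) :
  (\sum_(n <oo) (a n)%:E = 1)%E -> (forall n, 0 <= a n) -> 0 < e ->
  exists M, 1 - e <= \sum_(n < M) a n.
Proof.
move=> a1 a0 e0.
have : (\sum_(0 <= n < M) (a n)%:E @[M --> \oo] --> 1%:E)%E.
  rewrite -a1; apply: is_cvg_nneseries => n _ _; by rewrite lee_fin.
move=> /fine_cvgP[_ cv].
have [|M _ HM] := cvgr_gt _ cv (1 - e) (_ : 1 - e < 1); first lra.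
exists M; have /= := HM M (leqnn M).
by rewrite sumEFin/= big_mkord => /ltW.
Qed.

Lemma near_ltn M (Q : nat -> nat -> Prop) :
  (forall n, (n < M)%N -> \forall k \near \oo, Q k n) ->
  \forall k \near \oo, forall n, (n < M)%N -> Q k n.
Proof.
move=> QE.
have : \forall k \near \oo, forall i : 'I_M, Q k i.
  by apply: (@filter_forall _ _ (fun (i : 'I_M) k => Q k i)) => i; exact: QE.
by apply: filterS => k Qk n nM; exact: (Qk (Ordinal nM)).
Qed.

Lemma dominated_sup_dirac (X : mm) m : dominated (sup_mm (sup_dirac m)) X.
Proof.
exists (fun=> (fun=> 0)); split => [x x'|A mA] /=.
  by apply: supd_le => [|i]; rewrite ?mm_d_ge0// subrr normr0 mm_d_ge0.
rewrite /sup_dirac diracE; have [A0|A0] := boolP (_ \in A).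
  rewrite (_ : _ @^-1` A = setT) ?probability_setT//.
  by apply/seteqP; split => // x _ /=; exact: set_mem.
rewrite (_ : _ @^-1` A = set0) ?measure0//.
by apply/seteqP; split => // x /= /mem_set; rewrite (negbTE A0).
Qed.

Section Recovery.
Variables (a : nat -> RR) (ak : nat -> nat -> RR).
Variables (P : nat -> mm -> Prop) (Pk : nat -> nat -> mm -> Prop).
Hypotheses (a0 : forall n, 0 <= a n) (a1 : (\sum_(n <oo) (a n)%:E = 1)%E).
Hypotheses (ak0 : forall k n, 0 <= ak k n)
  (ak1 : forall k, (\sum_(n <oo) (ak k n)%:E = 1)%E).
Hypothesis ak_a : forall k n, 0 < ak k n -> 0 < a n.
Hypothesis akcvg : forall n, ak k n @[k --> \oo] --> a n.
Hypothesis Pk_ex : forall n k, 0 < a n -> exists X, Pk n k X.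
Hypothesis Pk_dom : forall n k X Y, 0 < a n -> Pk n k X -> dominated Y X ->
  Pk n k Y.
Hypothesis Pk_cvg : forall n X, 0 < a n -> P n X ->
  inf_box X (Pk n k) @[k --> \oo] --> (0 : RR).

Lemma mixture_recovery X (eta : RR) : mixture a P X -> 0 < eta ->
  \forall k \near \oo,
    exists2 Z, mixture (ak k) (Pk^~ k) Z & boxd X Z <= eta.
Proof.
move=> [nu [Pnu nuE]] eta0.
(* The minimum with 1 ensures [e < 1] for [boxd_transfer]. Distortion and missing mass will both be
   at most [4 * e], hence at most [eta]. *)
pose e : RR := Num.min eta 1 / 8.
have min0 : 0 < Num.min eta 1 by rewrite lt_min eta0 ltr01.
have min1 : Num.min eta 1 <= 1 by rewrite ge_min lexx orbT.
have mine : Num.min eta 1 <= eta by rewrite ge_min lexx.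
have e0 : 0 < e by rewrite /e; lra.
have e1 : e < 1 by rewrite /e; lra.
have e4 : 4 * e <= eta by rewrite /e; lra.
have [s ds] := @mm_separable X.
have [m mK] := dense_balls_mass (mm_mu X) ds e0.
have [M aM] := series_head a1 a0 e0.
pose phi (i : 'I_m) x := mm_d (s i) x.
have phi0 i x : 0 <= phi i x by exact: mm_d_ge0.
have philip i x y : phi i x <= phi i y + mm_d x y.
  by rewrite /phi (mm_dC x y); exact: mm_dtri.
have near1 : \forall k \near \oo, forall n, (n < M)%N ->
    0 < a n -> inf_box (mm_with (nu n)) (Pk n k) < e.
  apply: near_ltn => n _; have [an0|an0] := ltP 0 (a n); last by apply: nearW.
  apply: filterS (cvgr_real_dist_lt (Pk_cvg an0 (Pnu n an0)) e0) => k;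
  rewrite sub0r normrN => lte _.
  exact: le_lt_trans (ler_norm _) lte.
have near2 : \forall k \near \oo, forall n, (n < M)%N ->
    `|a n - ak k n| < e / M.+1%:R.
  have eM : 0 < e / M.+1%:R by rewrite divr_gt0.
  by apply: near_ltn => n _; exact: (cvgr_real_dist_lt (@akcvg n) eM).
apply: filterS2 near1 near2 => k {}near1 {}near2.
(* Only the first [M] summands are matched with those of [X]. Later ones of positive weight receive
   the Dirac mass, which stays in [Pk n k]. *)
have tpE n : exists tp : probability (sup_space m) RR *
    probability (mm_car X * sup_space m)%type RR,
    (0 < a n -> Pk n k (sup_mm tp.1)) /\
    ((n < M)%N -> 0 < a n ->
    [/\ forall A, measurable A -> tp.2 (A `*` setT) = nu n A,
        forall B, measurable B -> tp.2 (setT `*` B) = tp.1 B &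
        1 - e <= fine (tp.2 (graph_nbhd phi e))]).
  have [an0|an0] := ltP 0 (a n); last first.
    have [pi _] := prob_product (mm_mu X) (sup_dirac m).
    by exists (sup_dirac m, pi).
  have [nM|nM] := ltnP n M; last first.
    have [pi _] := prob_product (mm_mu X) (sup_dirac m).
    exists (sup_dirac m, pi); split => //= _.
    have [Y PY] := Pk_ex k an0.
    exact: Pk_dom an0 PY (dominated_sup_dirac _ _).
  have [Y PY bY] := inf_box_lt (Pk_ex k an0) (near1 n nM an0).
  have [tau [pi [tauY piX piV piG]]] :=
    @boxd_transfer (mm_with (nu n)) Y m phi e phi0 philip bY e1.
  by exists (tau, pi); split => //= _; exact: Pk_dom an0 PY tauY.
have [tp {}tpE] := choice tpE.
have [Q QE] := prob_mixture (fun n => (tp n).1) (ak0 k) (ak1 k).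
exists (sup_mm Q).
  exists (fun n => (tp n).1); split => [n akn0|A mA]; last exact: QE.
  by have [+ _] := tpE n; apply; exact: ak_a akn0.
(* The minimum keeps the weighted couplings below [mm_mu X] on one side and below [Q] on the
   other. *)
pose w n : RR := Num.min (a n) (ak k n).
have w0 n : 0 <= w n by rewrite le_min a0 ak0.
have wa n : w n <= a n by rewrite ge_min lexx.
have wak n : w n <= ak k n by rewrite ge_min lexx orbT.
have waD n : a n - `|a n - ak k n| <= w n.
  rewrite le_min; have := ler_norm (a n - ak k n).
  by have := normr_ge0 (a n - ak k n) => *; apply/andP; split; lra.
have w_eq0 n : a n <= 0 -> w n = 0.
  by move=> an0; apply/eqP; rewrite eq_le w0 (le_trans (wa n)).
have wX A n : (n < M)%N -> measurable A ->
    w n * fine ((tp n).2 (A `*` setT)) = w n * fine (nu n A).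
  move=> nM mA; have [an0|an0] := ltP 0 (a n); last by rewrite w_eq0// !mul0r.
  by have [_ /(_ nM an0)[tX _ _]] := tpE n; rewrite tX.
have wZ B n : (n < M)%N -> measurable B ->
    w n * fine ((tp n).2 (setT `*` B)) = w n * fine ((tp n).1 B).
  move=> nM mB; have [an0|an0] := ltP 0 (a n); last by rewrite w_eq0// !mul0r.
  by have [_ /(_ nM an0)[_ tZ _]] := tpE n; rewrite tZ.
pose K := \big[setU/set0]_(i < m) [set x | mm_d (s i) x < e].
have mKm : measurable K by apply: bigsetU_measurable => i _; exact: ball_measurable.
pose G := graph_nbhd phi e.
have mG : measurable G by exact: graph_nbhd_measurable.
have mKT : measurable (K `*` [set: sup_space m]) by exact: measurableX.
have marginX A : measurable A ->
    \sum_(n < M) w n * fine ((tp n).2 (A `*` setT)) <= fine (mm_mu X A).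
  move=> mA; apply: le_trans (pr_mixture_partial M a0 mA (nuE A mA)).
  by apply: ler_sum => n _; rewrite wX// ler_wpM2r// fine_ge0.
apply: (@boxd_le_finite_mixture X (sup_mm Q) eta M w (fun n => (tp n).2)
  (G `&` (K `*` setT))) => //.
- move=> B mB; apply: le_trans (pr_mixture_partial M (ak0 k) mB (QE B)).
  by apply: ler_sum => n _; rewrite wZ// ler_wpM2r// fine_ge0.
- exact: measurableI.
- move=> p q [Gp [Kp _]] [Gq _] /=; rewrite ler_norml.
  have up : supd p.2 q.2 <= mm_d p.1 q.1 + 2 * e.
    apply: supd_le => [|i]; first by rewrite addr_ge0 ?mm_d_ge0//; lra.
    have := Gp i; have := Gq i; have := philip i p.1 q.1; have := philip i q.1 p.1.
    rewrite (mm_dC q.1) !ler_norml => ? ? /andP[? ?] /andP[? ?].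
    by apply/andP; split; lra.
  (* Distances from a centre [s j] within [e] of [p.1] recover the distance of [p.1] and [q.1] up to
     [2 * e]; the tube adds another [2 * e]. *)
  have dn : mm_d p.1 q.1 <= supd p.2 q.2 + 4 * e.
    move: Kp; rewrite /K -(bigcup_mkord m (fun i => [set x | mm_d (s i) x < e])).
    move=> [j /= jm pj]; have := supd_ge p.2 q.2 (Ordinal jm).
    have := Gp (Ordinal jm); have := Gq (Ordinal jm); rewrite /phi/=.
    have := mm_dtri p.1 (s j) q.1; rewrite (mm_dC p.1 (s j)) !ler_norml.
    by move=> ? /andP[? ?] /andP[? ?] /andP[? ?]; lra.
  by apply/andP; split; lra.
- exact: ltW.
have step1 : \sum_(n < M) (w n * (1 - e) - w n * fine ((tp n).2 ((~` K) `*` setT))) <=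
    \sum_(n < M) w n * fine ((tp n).2 (G `&` K `*` setT)).
  apply: ler_sum => n _; have [an0|an0] := ltP 0 (a n); last first.
    by rewrite w_eq0// !mul0r subr0.
  rewrite -mulrBr ler_wpM2l//.
  apply: le_trans (prI_ge (tp n).2 mG mKT).
  have -> : ~` (K `*` [set: sup_space m]) = ~` K `*` setT.
    by apply/seteqP; split => -[x z] /=; tauto.
  rewrite lerB//.
  by have [_ /(_ (ltn_ord n) an0)[_ _]] := tpE n.
apply: le_trans step1; rewrite sumrB -mulr_suml.
have := marginX _ (measurableC mKm); rewrite prC//.
have : \sum_(n < M) `|a n - ak k n| <= e.
  apply: (@ler_sum_const _ M (fun n => `|a n - ak k n|)) => [|n nM].
    exact: ltW.
  exact/ltW/near2.
have : \sum_(n < M) (a n - `|a n - ak k n|) <= \sum_(n < M) w n.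
  by apply: ler_sum => n _; exact: waD.
rewrite sumrB.
move: aM mK; rewrite -/K.
set x1 := \sum_(n < M) a n; set x2 := fine _; set x3 := \sum_(n < M) w n.
set x4 := \sum_(n < M) `|_|; set x5 := \sum_(n < M) _ * _.
(* The tail beyond [M] and the change of weights cost [e] each, the tube [e], and the complement of
   [K] another [e]. *)
move=> *; have : x3 * (1 - e) >= (1 - 2 * e) * (1 - e) by rewrite ler_wpM2r//; lra.
by nra.
Qed.

End Recovery.

(** * Limits of members *)

(** The lower limit is the supremum of the tail infima, so it is positive exactly when one tail has
    a positive lower bound. A tail infimum cannot be infinite from above, being below a real
    term. *)
Lemma limn_einf_gt0 (R : realType) (u : nat -> R) :
  (0 < limn_einf (fun k => (u k)%:E))%E <->
  exists2 c, 0 < c & \forall k \near \oo, c <= u k.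
Proof.
rewrite limn_einf_lim (cvg_lim _ (@cvg_einfs_sup _ _))//; split.
  move=> /ereal_sup_gt[_ [n _ <-]] un0.
  have ule k : (n <= k)%N -> (einfs (fun k => (u k)%:E) n <= (u k)%:E)%E.
    by move=> nk; apply: ereal_inf_lbound; exists k.
  have : (einfs (fun k => (u k)%:E) n <= (u n)%:E)%E by exact: ule.
  case: (einfs _ n) un0 ule => [c| |]// c0 ule _.
  by exists c => //; exists n => // k /= nk; rewrite -lee_fin; exact: ule.
move=> [c c0 [n _ nc]]; apply: (@lt_le_trans _ _ c%:E) => //.
apply: (@le_trans _ _ (einfs (fun k => (u k)%:E) n)).
  by apply: le_ereal_inf_tmp => _ [k /= nk <-]; rewrite lee_fin; exact: nc.
by apply: ereal_sup_ubound; exists n.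
Qed.

Section Limit.
Variables (a : nat -> RR) (ak : nat -> nat -> RR).
Variables (P : nat -> mm -> Prop) (Pk : nat -> nat -> mm -> Prop).
Hypotheses (a0 : forall n, 0 <= a n) (a1 : (\sum_(n <oo) (a n)%:E = 1)%E).
Hypotheses (ak01 : forall k n, 0 <= ak k n <= 1)
  (ak1 : forall k, (\sum_(n <oo) (ak k n)%:E = 1)%E).
Hypothesis ak_a : forall k n, 0 < ak k n -> 0 < a n.
Hypothesis akcvg : forall n, ak k n @[k --> \oo] --> a n.
Hypothesis Pk_ex : forall n k, 0 < a n -> exists X, Pk n k X.
Hypothesis Pk_dom : forall n k X Y, 0 < a n -> Pk n k X -> dominated Y X ->
  Pk n k Y.
Hypothesis Pk_liminf : forall n X, 0 < a n -> ~ P n X ->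
  (0 < limn_einf (fun k => (inf_box X (Pk n k))%:E))%E.

(** Guarantees that a small [inf_box] is witnessed by an actual member, as [inf_box_lt] requires;
    the one-point space is such a member. *)
Lemma mixture_nonempty k : exists Z, mixture (ak k) (Pk^~ k) Z.
Proof.
have ak0 n : 0 <= ak k n by have /andP[] := ak01 k n.
have [Q QE] := prob_mixture (fun=> sup_dirac 0) ak0 (ak1 k).
exists (sup_mm Q), (fun=> sup_dirac 0); split => [n akn0|A mA]; last exact: QE.
have [Y PY] := Pk_ex k (ak_a akn0).
exact: Pk_dom (ak_a akn0) PY (dominated_sup_dirac _ _).
Qed.

Lemma mixture_limit X :
  (forall (e : RR) K, 0 < e -> exists2 k, (K <= k)%N &
    inf_box X (mixture (ak k) (Pk^~ k)) < e) ->
  mixture a P X.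
Proof.
move=> near_X.
have ksE j : exists ks : nat * (nat -> probability (mm_car X) RR),
    [/\ (j <= ks.1)%N,
      forall A, measurable A ->
        mm_mu X A = (\sum_(n <oo) (ak ks.1 n)%:E * ks.2 n A)%E &
      forall n, 0 < ak ks.1 n -> exists2 Y, Pk n ks.1 Y &
        boxd (mm_with (ks.2 n)) Y <= j.+1%:R^-1 / ak ks.1 n].
  have [|k jk bk] := near_X (j.+1%:R^-1) j; first by rewrite invr_gt0.
  have [Z mZ bZ] := inf_box_lt (mixture_nonempty k) bk.
  have [sigma [sigmaX sigmaP]] := mixture_near (ak01 k) mZ bZ.
  by exists (k, sigma).
have [ks {}ksE] := choice ksE.
(* One ultrafilter finer than the eventual filter yields the limits for all [n] and all sets at
   once, without extracting subsequences. *)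
have [U [UU ooU]] := ultraFilterLemma (@eventually_filter).
have akU n : ak (ks j).1 n @[j --> U] --> a n.
  move=> V /akcvg[K _ KV]; apply: ooU; exists K => // j /= Kj.
  by apply: KV; rewrite /=; apply: leq_trans Kj _; have [] := ksE j.
have [||tau [taucvg tauE]] := @ultralimit_mixture _ _ _ (mm_mu X) U a
  (fun j => ak (ks j).1) (fun j => (ks j).2) UU a0 a1 _ akU.
- by move=> j n; have /andP[] := ak01 (ks j).1 n.
- by move=> j A mA; have [_ + _] := ksE j; apply.
(* Otherwise the weak convergence of the [n]-th pyramids keeps [mm_with (tau n)] at distance at
   least some [c] from [Pk n k] for all large [k]; a closer member is now produced. *)
exists tau; split => // n an0; apply: contrapT => nP.
have /limn_einf_gt0[c c0 [K _ Kc]] := Pk_liminf an0 nP.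
have PU : ProperFilter U by exact: ultra_proper.
(* The final bound is [2 * del + 4 * (2 * del)], that is [10 * del], which is less than [c]. *)
pose del : RR := c / 16.
have del0 : 0 < del by rewrite /del; lra.
have [m [A [mA tA dA tauA]]] := small_partition (tau n) del0.
have nearA : \forall j \near U, forall i : 'I_m,
    `|fine (tau n (A i)) - fine ((ks j).2 n (A i))| < del / m.+1%:R.
  apply: (@filter_forall _ _ (fun (i : 'I_m) j =>
    `|fine (tau n (A i)) - fine ((ks j).2 n (A i))| < del / m.+1%:R)) => i.
  apply: (cvgr_real_dist_lt (taucvg n _ an0 (mA i))).
  by rewrite divr_gt0.
have nearak : \forall j \near U, `|a n - ak (ks j).1 n| < a n / 2.
  by apply: (cvgr_real_dist_lt (akU n)); rewrite divr_gt0.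
have nearK : \forall j \near U, (K <= j)%N by apply: ooU; exists K.
have nearj : \forall j \near U, j.+1%:R^-1 < del * (a n / 2).
  apply: ooU; apply: (near_infty_natSinv_lt (PosNum (_ : 0 < del * (a n / 2)))).
  by rewrite mulr_gt0// divr_gt0.
have [j [[jA jak] [jK jj]]] :=
  filter_ex (filterI (filterI nearA nearak) (filterI nearK nearj)).
have [jk _ jP] := ksE j.
have akj : a n / 2 < ak (ks j).1 n.
  by move: jak; rewrite ltr_norml => /andP[? ?]; lra.
have an2 : 0 < a n / 2 by rewrite divr_gt0.
have [|Y PY bY] := jP n; first exact: lt_trans akj.
have distA : \sum_(i < m) `|fine (tau n (A i)) - fine ((ks j).2 n (A i))| <= del.
  apply: (@ler_sum_const _ m (fun i =>
      `|fine (tau n (A i)) - fine ((ks j).2 n (A i))|)).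
    exact: ltW.
  by move=> i im; exact/ltW/(jA (Ordinal im)).
have bY' : boxd (mm_with ((ks j).2 n)) Y < 2 * del.
  apply: le_lt_trans bY _; rewrite ltr_pdivrMr; last exact: lt_trans akj.
  apply: lt_le_trans jj _; apply: ler_pM; [exact: ltW|exact: ltW| |exact: ltW].
  by lra.
have : boxd (mm_with (tau n)) Y <= 2 * del + 4 * (2 * del).
  (* The tolerance doubles because the cells carry mass [1 - del] for [tau n], and passing to the
     measure at stage [j] costs up to [del] more. *)
  apply: (@boxd_perturb X Y (tau n) ((ks j).2 n) m A (2 * del) (2 * del)) => //.
  - by lra.
  - by move=> i x y Ax Ay; apply: le_trans (dA _ _ _ Ax Ay) _; lra.
  - by lra.
  - have : \sum_(i < m) (fine (tau n (A i)) -
        `|fine (tau n (A i)) - fine ((ks j).2 n (A i))|) <=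
        \sum_(i < m) fine ((ks j).2 n (A i)).
      apply: ler_sum => i _.
      by have := ler_norm (fine (tau n (A i)) - fine ((ks j).2 n (A i))); lra.
    by rewrite sumrB; lra.
have := Kc (ks j).1 (leq_trans jK jk).
have := inf_box_le (mm_with (tau n)) PY.
by rewrite /del; lra.
Qed.

End Limit.

(** * Direct sums *)

(** Extension by zero turns sums over [N] into series over all naturals, so that finite and infinite
    [N] are treated together. *)
Definition extend0 (N : nbar) (a : nat -> RR) (n : nat) : RR :=
  if `[< idx N n >] then a n else 0.

Lemma extend0E N a n : idx N n -> extend0 N a n = a n.
Proof. by move=> Nn; rewrite /extend0 asboolT. Qed.

Lemma extend0_gt0 N a n : 0 < extend0 N a n -> idx N n.
Proof. by rewrite /extend0; case: asboolP => //; rewrite ltxx. Qed.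

Lemma sumN_series N (f : nat -> \bar RR) : (forall n, idx N n -> 0 <= f n)%E ->
  sumN N f = (\sum_(n <oo) (if `[< idx N n >] then f n else 0))%E.
Proof.
case: N => [m|] f0 /=; last by apply: eq_eseriesr => n _; rewrite asboolT.
rewrite (nneseries_split 0 m); last by move=> n _; case: asboolP => // /f0.
rewrite eseries0 ?adde0 ?add0n; last first.
  by move=> n mn _; rewrite asboolF//= => /(leq_ltn_trans mn); rewrite ltnn.
by rewrite big_mkord; apply: eq_bigr => n _; rewrite asboolT//=.
Qed.

Lemma sumN_extend0 N a (x : nat -> \bar RR) : (forall n, idx N n -> 0 <= a n) ->
  (forall n, 0 <= x n)%E ->
  sumN N (fun n => ((a n)%:E * x n)%E) =
  (\sum_(n <oo) (extend0 N a n)%:E * x n)%E.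
Proof.
move=> a0 x0; rewrite sumN_series.
  apply: eq_eseriesr => n _; rewrite /extend0.
  by case: asboolP => // _; rewrite mul0e.
by move=> n Nn; rewrite mule_ge0// lee_fin a0.
Qed.

Lemma dsum_mixture N a (P : nat -> mm -> Prop) :
  (forall n, idx N n -> 0 < a n) ->
  (forall n X Y, idx N n -> P n X -> dominated Y X -> P n Y) ->
  dsum N a P = mixture (extend0 N a) P.
Proof.
move=> a0 Pdom; apply/funext => X; apply/propext; split.
  move=> [Xs [f [PXs flip muE]]].
  have nuE n : exists nu : probability (mm_car X) RR, idx N n ->
      P n (mm_with nu) /\ forall A, nu A = mm_mu (Xs n) (f n @^-1` A).
    have [Nn|Nn] := pselect (idx N n); last by exists (mm_mu X).
    have [nu [nuX nuE]] := dominated_pushforward (flip n Nn).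
    by exists nu => _; split => //; exact: Pdom (PXs n Nn) nuX.
  have [nu {}nuE] := choice nuE.
  exists nu; split=> [n /extend0_gt0 /nuE[]//|A mA].
  rewrite muE// sumN_series; last first.
    by move=> n Nn; rewrite mule_ge0// lee_fin ltW// a0.
  apply: eq_eseriesr => n _; rewrite /extend0; case: asboolP => Nn.
    by have [_ ->] := nuE n Nn.
  by rewrite mul0e.
move=> [nu [Pnu nuE]].
exists (fun n => mm_with (nu n)), (fun n => id); split.
- by move=> n Nn; apply: Pnu; rewrite extend0E// a0.
- by move=> n _ x x'; exact: lexx.
- move=> A mA; rewrite sumN_extend0; first exact: nuE.
    by move=> n Nn; rewrite ltW// a0.
  by move=> n; exact: measure_ge0.
Qed.

Theorem theorem3p18 (N : nbar) (a : nat -> RR) (ak : nat -> nat -> RR)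
    (P : nat -> mm -> Prop) (Pk : nat -> nat -> mm -> Prop) :
  inA1 N a ->
  (forall k, inA1 N (ak k)) ->
  (forall n, idx N n -> pyramid (P n)) ->
  (forall n k, idx N n -> pyramid (Pk n k)) ->
  (fun k => sumN N (fun n => (`| ak k n - a n |)%:E)) @ \oo --> 0%E ->
  (forall n, idx N n -> weak_conv (fun k => Pk n k) (P n)) ->
  weak_conv (fun k => dsum N (ak k) (fun n => Pk n k)) (dsum N a P).
Proof.
move=> [a01 a1] akA pyrP pyrPk akcvg wconv.
have a_gt0 n : idx N n -> 0 < a n by move=> /a01/andP[].
have ak_gt0 k n : idx N n -> 0 < ak k n by move=> /(akA k).1/andP[].
have mixk k : dsum N (ak k) (fun n => Pk n k) =
    mixture (extend0 N (ak k)) (Pk^~ k).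
  apply: dsum_mixture; first exact: ak_gt0.
  by move=> n X Y Nn; have [_ _ + _] := pyrPk n k Nn; exact.
have mix : dsum N a P = mixture (extend0 N a) P.
  apply: dsum_mixture => // n X Y Nn.
  by have [_ _ + _] := pyrP n Nn; exact.
pose b := extend0 N a; pose bk k := extend0 N (ak k).
have b0 n : 0 <= b n by rewrite /b /extend0; case: asboolP => // /a_gt0/ltW.
have bk01 k n : 0 <= bk k n <= 1.
  rewrite /bk /extend0; case: asboolP => [Nn|_]; last by rewrite lexx ler01.
  by have /andP[/ltW -> ->] := (akA k).1 n Nn.
have bk0 k n : 0 <= bk k n by have /andP[] := bk01 k n.
have sum1 (c : nat -> RR) : (forall n, idx N n -> 0 < c n) ->
    sumN N (fun n => (c n)%:E) = 1%E -> (\sum_(n <oo) (extend0 N c n)%:E = 1)%E.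
  move=> c0 <-; rewrite sumN_series; last by move=> n /c0/ltW; rewrite lee_fin.
  by apply: eq_eseriesr => n _; rewrite /extend0; case: asboolP.
have b1 : (\sum_(n <oo) (b n)%:E = 1)%E by exact: sum1.
have bk1 k : (\sum_(n <oo) (bk k n)%:E = 1)%E.
  by apply: sum1; [exact: ak_gt0|exact: (akA k).2].
have bk_b k n : 0 < bk k n -> 0 < b n.
  by move=> /extend0_gt0 Nn; rewrite /b extend0E// a_gt0.
have b_idx n : 0 < b n -> idx N n by exact: extend0_gt0.
(* Each difference of weights is one term of the sum that tends to 0; outside [N] both weights
   vanish. *)
have bkcvg n : bk k n @[k --> \oo] --> b n.
  have [Nn|Nn] := pselect (idx N n); last first.
    rewrite (_ : (fun k => bk k n) = cst (b n)); first exact: cvg_cst.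
    by apply/funext => k; rewrite /bk /b /extend0 !asboolF.
  apply: real_cvgr_dist_le => e e0.
  have := akcvg => /fine_cvgP[fin cv].
  apply: filterS2 fin (cvgr_real_dist_lt cv e0) => k fk.
  rewrite /bk /b !extend0E// sub0r normrN => lte.
  rewrite distrC; apply: le_trans (ltW lte); apply: le_trans (ler_norm _).
  rewrite -lee_fin fineK// sumN_series//.
  apply: le_trans (nneseries_ge_term n _) => /=; first by rewrite asboolT.
  by move=> j; case: asboolP.
have Pk_ex n k : 0 < b n -> exists X, Pk n k X.
  by move=> /b_idx Nn; have [] := pyrPk n k Nn.
have Pk_dom n k X Y : 0 < b n -> Pk n k X -> dominated Y X -> Pk n k Y.
  by move=> /b_idx Nn; have [_ _ + _] := pyrPk n k Nn; exact.
rewrite mix; split=> [X mX|X nmX].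
  apply: real_cvgr_dist_le => e e0.
  have := @mixture_recovery b bk P Pk b0 b1 bk0 bk1 bk_b bkcvg Pk_ex Pk_dom _ X e mX e0.
  case=> [n Y /b_idx Nn PY|K _ KP].
    by have [+ _] := wconv n Nn; exact.
  exists K => // k /= Kk; have [Z mZ bZ] := KP k Kk.
  rewrite mixk sub0r normrN ger0_norm; last by apply: inf_box_ge0; exists Z.
  exact: le_trans (inf_box_le X mZ) bZ.
(* By contraposition: without an eventual positive lower bound, [inf_box X] falls below every [e] at
   arbitrarily late stages, which is what [mixture_limit] takes as input. *)
apply/limn_einf_gt0; apply: contrapT => nlim; apply: nmX.
apply: (@mixture_limit b bk P Pk b0 b1 bk01 bk1 bk_b bkcvg Pk_ex Pk_dom).
  by move=> n Y /b_idx Nn; have [_ +] := wconv n Nn; exact.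
move=> e K e0; apply: contrapT => nK; apply: nlim.
exists e => //; exists K => // k /= Kk; rewrite mixk leNgt; apply/negP => lte.
by apply: nK; exists k.
Qed.
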